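(* Let $\beta=\sigma_{i_1}\cdots\sigma_{i_r}\in \mathrm{Br}_k^+$ be a positive braid containing a reduced expression for $w_0\in S_k$ as a (not necessarily consecutive) subword. For each $r_1\in\{1,\dots,r\}$ put $\beta^1=\sigma_{i_1}\cdots\sigma_{i_{r_1}}$ and $\beta^2=\sigma_{i_{r_1+1}}\cdots\sigma_{i_r}$. For $w\in S_k$ let $$\mathcal{U}_{r_1,w}=\{(\mathcal{F}^0,\dots,\mathcal{F}^r)\in X(\beta)\mid \mathcal{F}^{r_1}\pitchfork\mathcal{F}(w_0w)\}\subseteq X(\beta).$$ Then for each $r_1=1,\dots,r$ and each $w\in S_k$ there is an isomorphism of algebraic varieties $$\Psi_{r_1,w}: X\big(\underline{(w^{-1}w_0)}\,\beta^1\big)\times X\big(\beta^2\,\underline{w}\big)\xrightarrow{\ \cong\ }\mathcal{U}_{r_1,w}.$$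
   Context: $S_k$ is the symmetric group with simple transpositions $s_1,\dots,s_{k-1}$ and longest element $w_0$. $\mathrm{Br}_k^+$ is the positive braid monoid on $k$ strands with generators $\sigma_1,\dots,\sigma_{k-1}$. For $u\in S_k$, $\underline{u}\in\mathrm{Br}_k^+$ is the minimal-length positive lift of $u$ (replace $s_i$ by $\sigma_i$ in any reduced expression of $u$). $\mathrm{Fl}_k$ is the variety of complete flags in $\mathbb{C}^k$. For $w\in S_k$, the coordinate flag $\mathcal{F}(w)$ has $j$-th subspace spanned by $e_{w(1)},\dots,e_{w(j)}$; $\mathcal{F}^{\mathrm{std}}=\mathcal{F}(e)$ and $\mathcal{F}^{\mathrm{ant}}=\mathcal{F}(w_0)$. Two flags are in relative position $w$, written $\mathcal{F}\xrightarrow{w}\mathcal{F}'$, if there is $g\in\mathrm{GL}(k)$ with $g\mathcal{F}=\mathcal{F}^{\mathrm{std}}$ and $g\mathcal{F}'=\mathcal{F}(w)$. They are transverse, $\mathcal{F}\pitchfork\mathcal{F}'$, if $\mathcal{F}\xrightarrow{w_0}\mathcal{F}'$. For a positive braid word $\beta=\sigma_{i_1}\cdots\sigma_{i_r}$, the braid variety $X(\beta)$ is the variety of tuples of flags $(\mathcal{F}^0,\dots,\mathcal{F}^r)$ with $\mathcal{F}^0=\mathcal{F}^{\mathrm{std}}$, $\mathcal{F}^r=\mathcal{F}^{\mathrm{ant}}$ and $\mathcal{F}^{j-1}\xrightarrow{s_{i_j}}\mathcal{F}^j$ for all $j=1,\dots,r$. Up to canonical isomorphism it depends only on the braid and not on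 the word. Braid varieties (and the open sets $\mathcal{U}_{r_1,w}$) are allowed to be empty. *)

(* Defs.v *)
From HB Require Import structures.
From mathcomp Require Import all_boot all_order all_fingroup all_algebra.
From mathcomp Require Import mpoly.

Set Implicit Arguments.
Unset Strict Implicit.
Unset Printing Implicit Defensive.

Import GRing.Theory.
Local Open Scope ring_scope.

(** Throughout, k = n.+1, and the letter i : 'I_n (0-based) stands for
    sigma_{i+1}.  Strands, basis vectors and permutations are 0-based too. *)

Section Permutations.
Variable n : nat.
Implicit Types (u v w : 'S_n.+1) (a : seq 'I_n).

(** MathComp multiplies permutations left to right: (v * u) x = u (v x).
    The product uv of the text is composition of functions. *)
Definition permc u v : 'S_n.+1 := (v * u)%g.

Lemma permcE u v x : permc u v x = u (v x).
Proof. exact: permM. Qed.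

Definition simple_tr (i : 'I_n) : 'S_n.+1 := tperm (inord i) (inord i.+1).

(** The longest element: it reverses the order. *)
Definition w0 : 'S_n.+1 := perm (@rev_ord_inj n.+1).

Definition word_perm a : 'S_n.+1 := foldr (fun i u => permc (simple_tr i) u) 1%g a.

(** As a positive braid word, such an [a] represents the positive lift of [u]. *)
Definition reduced_expr u a : Prop :=
  word_perm a = u /\ forall b, word_perm b = u -> (size a <= size b)%N.

End Permutations.

Arguments w0 {n}.

Section Flags.
Variables (K : fieldType) (n : nat).

Definition is_flag (F : {ffun 'I_n.+2 -> {vspace 'cV[K]_n.+1}}) : bool :=
  [forall j : 'I_n.+2, \dim (F j) == j] &&
  [forall i : 'I_n.+2, forall j : 'I_n.+2, (i <= j)%N ==> (F i <= F j)%VS].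

Record flag := Flag {
  flag_space :> {ffun 'I_n.+2 -> {vspace 'cV[K]_n.+1}};
  flagP : is_flag flag_space }.

HB.instance Definition _ := [isSub for flag_space].
HB.instance Definition _ := [Equality of flag by <:].

Definition col_span (g : 'M[K]_n.+1) (j : nat) : {vspace 'cV[K]_n.+1} :=
  <<[seq col i g | i : 'I_n.+1 <- enum 'I_n.+1 & (i < j)%N]>>%VS.

Lemma col_flag_subproof (g : 'M[K]_n.+1) :
  g \in unitmx -> is_flag [ffun j : 'I_n.+2 => col_span g j].
Proof.
move=> gU.
have sub (i j : nat) : (i <= j)%N -> (col_span g i <= col_span g j)%VS.
  move=> le_ij; apply: sub_span => x /mapP[m].
  rewrite mem_filter => /andP[lt_mi _] ->; apply: map_f.
  by rewrite mem_filter (leq_trans lt_mi le_ij) mem_enum.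
apply/andP; split; last first.
  by apply/forallP=> i; apply/forallP=> j; apply/implyP=> /sub; rewrite !ffunE.
pose e := [tuple of [seq col i g | i <- enum 'I_n.+1]].
have full : (fullv <= <<e>>)%VS.
  apply/subvP=> v _; rewrite -[v]mul1mx -(mulmxV gU) -mulmxA.
  have -> : g *m (invmx g *m v) = \sum_i (invmx g *m v) i 0 *: col i g.
    apply/matrixP=> i j; rewrite mxE summxE; apply: eq_bigr => l _.
    by rewrite !mxE ord1 mulrC.
  apply: memv_suml => i _; apply/memvZ/memv_span.
  by apply: map_f; rewrite mem_enum.
have free_e : free e.
  rewrite /free eqn_leq dim_span /=.
  apply: leq_trans (dimvS full).
  by rewrite dimvf /dim /= size_map size_enum_ord muln1.
apply/forallP=> j; rewrite ffunE /col_span.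
set s := [seq i <- _ | _].
have free_s : free [seq col i g | i <- s].
  have : free ([seq col i g | i <- s] ++
      [seq col i g | i : 'I_n.+1 <- enum 'I_n.+1 & ~~ (i < j)%N]).
    rewrite -map_cat (perm_free (Y := e)) //.
    exact/perm_map/permEl/perm_filterC.
  exact: catl_free.
move: free_s; rewrite /free => /eqP ->; rewrite size_map /s size_filter.
rewrite -sum1_count big_enum_cond /=.
have le_j : (j <= n.+1)%N by rewrite -ltnS.
by rewrite -[X in _ == X]card_ord -sum1_card (big_ord_widen n.+1 (fun=> 1%N) le_j).
Qed.

(** The flag g F^std, whose j-th subspace is spanned by the first j columns. *)
Definition col_flag (g : 'M[K]_n.+1) (gU : g \in unitmx) : flag :=
  Flag (col_flag_subproof gU).

(** Column j is e_{w(j)}. *)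
Definition coord_mx (w : 'S_n.+1) : 'M[K]_n.+1 := \matrix_(i, j) (i == w j)%:R.

Lemma coord_mx_unit w : coord_mx w \in unitmx.
Proof.
have -> : coord_mx w = (perm_mx w)^T.
  by apply/matrixP=> i j; rewrite !mxE eq_sym.
by rewrite unitmx_tr unitmx_perm.
Qed.

Definition coord_flag (w : 'S_n.+1) : flag := col_flag (coord_mx_unit w).
Definition std_flag : flag := coord_flag 1.
Definition ant_flag : flag := coord_flag w0.

Definition moves_to (g : 'M[K]_n.+1) (F F' : flag) : Prop :=
  forall j, (linfun (mulmx g : 'cV[K]_n.+1 -> 'cV[K]_n.+1) @: F j)%VS = F' j.

Definition rel_pos (w : 'S_n.+1) (F F' : flag) : Prop :=
  exists2 g : 'M[K]_n.+1, g \in unitmx &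
    moves_to g F std_flag /\ moves_to g F' (coord_flag w).

Definition transverse : flag -> flag -> Prop := rel_pos w0.

End Flags.

Arguments std_flag {K n}.
Arguments ant_flag {K n}.

(** Quasi-projective geometry inside products Fl_k^I, for I a finite type.
    Fl_k is embedded by Plücker coordinates in the product of the projective
    spaces P(Lambda^j K^k), so Fl_k^I lies in a product of projective spaces
    indexed by pairs (i, j).  As usual, the topology and the regular functions
    are given by multihomogeneous polynomials in the coordinates, which are
    indexed by pairs (i, S) with S a set of #|S| = j rows.  (The factors j = 0
    and j = k are points.)  A variety is given by its set of K-points, which is
    appropriate for reduced varieties over an algebraically closed field. *)
Section Varieties.
Variables (K : fieldType) (n : nat).

(** [g] is then invertible, since its columns span F n.+1, of dimension n.+1. *)
Definition frame (g : 'M[K]_n.+1) (F : flag K n) : Prop :=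
  forall j : 'I_n.+2, F j = col_span g j.

Definition plucker (g : 'M[K]_n.+1) (S : {set 'I_n.+1}) : K :=
  \det (\matrix_(a < #|S|, b < #|S|) g (enum_val a) (inord b)).

Definition pt (I : finType) : Type := {ffun I -> flag K n}.

Section Functions.
Variable I : finType.
Implicit Types (x y : pt I) (h : I -> 'M[K]_n.+1).

Definition pcoord : finType := (I * {set 'I_n.+1})%type.
Definition plpoly : Type := {mpoly K[#|pcoord|]}.

Definition multihomog (d : I -> nat -> nat) (P : plpoly) : Prop :=
  forall m, m \in msupp P -> forall (i : I) (j : nat),
    (\sum_(t < #|pcoord|
        | ((enum_val t).1 == i) && (#|(enum_val t).2| == j)) m t = d i j)%N.

Definition frames h x : Prop := forall i, frame (h i) (x i).

Definition pleval (P : plpoly) h : K :=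
  P.@[fun t => plucker (h (enum_val t).1) (enum_val t).2].

(** For multihomogeneous [Q] this does not depend on the choice of frames. *)
Definition nonvanishing (Q : plpoly) x : Prop :=
  exists2 h, frames h x & pleval Q h != 0.

(** Zariski open subsets of X *)
Definition zopen (X W : pt I -> Prop) : Prop :=
  (forall x, W x -> X x) /\
  forall x, W x -> exists d (Q : plpoly),
    [/\ multihomog d Q, nonvanishing Q x &
        forall y, X y -> nonvanishing Q y -> W y].

Definition regular_on (W : pt I -> Prop) (f : pt I -> K) : Prop :=
  forall x, W x -> exists d (P Q : plpoly),
    [/\ multihomog d P, multihomog d Q, nonvanishing Q x &
        forall y h, W y -> frames h y -> pleval Q h != 0 ->
          f y = pleval P h / pleval Q h].

End Functions.

(** Only the values of [phi] on X matter. *)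
Definition morphism (I J : finType) (X : pt I -> Prop) (Y : pt J -> Prop)
    (phi : pt I -> pt J) : Prop :=
  [/\ forall x, X x -> Y (phi x),
      forall V, zopen Y V -> zopen X (fun x => X x /\ V (phi x)) &
      forall V f, zopen Y V -> regular_on V f ->
        regular_on (fun x => X x /\ V (phi x)) (f \o phi)].

Definition isomorphic (I J : finType) (X : pt I -> Prop) (Y : pt J -> Prop) :
    Prop :=
  exists (phi : pt I -> pt J) (psi : pt J -> pt I),
    [/\ morphism X Y phi, morphism Y X psi,
        forall x, X x -> psi (phi x) = x & forall y, Y y -> phi (psi y) = y].

(** The product variety, inside Fl_k^I * Fl_k^J = Fl_k^(I + J). *)
Definition prod_var (I J : finType) (X : pt I -> Prop) (Y : pt J -> Prop)
    (z : pt (I + J)%type) : Prop :=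
  X [ffun i => z (inl i)] /\ Y [ffun j => z (inr j)].

End Varieties.

Section Braid.
Variables (K : fieldType) (n : nat).

Definition braid_variety (beta : seq 'I_n)
    (F : pt K n 'I_(size beta).+1) : Prop :=
  [/\ F ord0 = std_flag, F ord_max = ant_flag &
      forall j : 'I_(size beta),
        rel_pos (simple_tr (tnth (in_tuple beta) j))
          (F (widen_ord (leqnSn _) j)) (F (lift ord0 j))].

(** Meant for r1 <= size beta *)
Definition U_var (beta : seq 'I_n) (r1 : nat) (w : 'S_n.+1)
    (F : pt K n 'I_(size beta).+1) : Prop :=
  braid_variety F /\ transverse (F (inord r1)) (coord_flag K (permc w0 w)).

End Braid.

Arguments braid_variety K {n} beta F.
Arguments U_var K {n} beta r1 w F.

(* Main.v *)
From HB Require Import structures.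
Require Import Defs.
From mathcomp Require Import all_boot all_order all_fingroup all_algebra.
From mathcomp Require Import complex reals mpoly boolp zify.

(** Let x = w^-1 w0, let U be the group of upper unitriangular matrices, and write
    F(y) for the coordinate flag of y.

    Take a point (F^0, ..., F^r) of the open set. Since F^r1 is transverse to
    F(w0 w) = x^-1 F(e), its translate x F^r1 is transverse to the standard flag,
    so there is a unique C in U such that C x F^r1 is antistandard
    ([transverse_std]). After translation by C x, the first r1 steps lead from
    C F(x) to the antistandard flag, and the remaining ones from there to
    C F(x w0). The reduced word a of x prolongs the first path backwards to the
    standard flag, by C times the path of coordinate flags along a; this is a
    point G of the first factor. In the same way the reduced word b of w prolongs
    the second path forwards to the standard flag; as w0 exchanges the standard
    and the antistandard flag, w0 times this path is a point H of the second
    factor.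

    Conversely, let (G, H) be given. A path along a reduced word is determined by
    its endpoints, being a U-translate of the coordinate path ([reduced_path]).
    So the two prolongations are A times and B times coordinate paths, with A and
    B in U, and what has to be found is one C in U that acts like A on F(x) and
    like B on F(x w0). The roots of U are the disjoint union of those fixing F(x)
    and those fixing F(x w0), which gives a factorisation of U and the existence
    of C ([unitri_common]), and which also makes C unique ([unitri_fix2]). The
    point F is then x^-1 C^-1 times the concatenation of the rest of G and of
    w0 times the rest of H.

    Both maps are algebraic. A flag depends algebraically on a point if it has,
    locally, a frame with regular entries; this holds for the components of the
    point itself, by charts whose entries are ratios of Plücker coordinates
    ([regular_flag_coord]), and it is enough for a map into a product of flag
    varieties to be a morphism ([morphism_regular_flags]). The only other
    ingredient is the matrix C, or its inverse. Being the unique element of U that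
    moves certain regular flags to fixed coordinate flags, it solves a linear
    system with regular coefficients, so it is regular by Cramer's rule
    ([regular_unitri]). *)

Set Implicit Arguments.
Unset Strict Implicit.
Unset Printing Implicit Defensive.
Import GRing.Theory.
Local Open Scope ring_scope.

(** * Flags as cosets of the upper triangular group *)

Section FlagsAsCosets.
Variables (K : fieldType) (n : nat).
Local Notation M := 'M[K]_n.+1.
Local Notation flag := (flag K n).
Implicit Types (g h A B : M) (F E : flag).

(** The Borel subgroup B, that is, the stabiliser of the standard flag. *)
Definition upper A : Prop := forall i j : 'I_n.+1, (j < i)%N -> A i j = 0.

Lemma col_mulmx p q (A : 'M[K]_(p, n.+1)) (B : 'M_(n.+1, q)) j :
  col j (A *m B) = A *m col j B.
Proof. by rewrite !colE mulmxA. Qed.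

Lemma col_span_last g (m : 'I_n.+1) :
  col_span g m.+1 = (col_span g m + <[col m g]>)%VS.
Proof.
have sub (i j : nat) : (i <= j)%N -> (col_span g i <= col_span g j)%VS.
  move=> le_ij; apply: sub_span => x /mapP[l].
  rewrite mem_filter => /andP[lt_l _] ->; apply: map_f.
  by rewrite mem_filter (leq_trans lt_l le_ij) mem_enum.
apply/eqP; rewrite eqEsubv subv_add sub //= -memvE.
apply/andP; split; last first.
  by apply/memv_span/map_f; rewrite mem_filter leqnn mem_enum.
apply/span_subvP => v /mapP[l]; rewrite mem_filter ltnS => /andP[le_l _] ->.
have [lt_l|ge_l] := ltnP l m.
  apply: (subvP (addvSl _ _)); apply/memv_span/map_f.
  by rewrite mem_filter lt_l mem_enum.
have -> : l = m by apply/val_inj/eqP; rewrite eqn_leq le_l.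
exact/(subvP (addvSr _ _))/memv_line.
Qed.

Lemma col_span0 g : col_span g 0 = 0%VS.
Proof.
rewrite /col_span; set s := [seq i <- _ | _].
suff -> : s = [::] by rewrite /= span_nil.
by apply/eqP; rewrite -size_eq0 size_filter -leqn0 leqNgt -has_count; apply/hasPn.
Qed.

Lemma mulmx_col_span0 m (A : 'M[K]_(m, n.+1)) g (j : nat) :
  (forall i : 'I_n.+1, (i < j)%N -> A *m col i g = 0) ->
  forall v, v \in col_span g j -> A *m v = 0.
Proof.
move=> Ag0 v; rewrite /col_span; set s := [seq _ | _ <- _ & _] => sv.
have /coord_span-> : v \in <<in_tuple s>>%VS by [].
rewrite mulmx_sumr big1 // => l _; rewrite -scalemxAr.
have /mapP[k] : (in_tuple s)`_l \in s by rewrite mem_nth.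
by rewrite mem_filter => /andP[lt_kj _] ->; rewrite Ag0 // scaler0.
Qed.

(** The entries of [invmx g *m v] are the coordinates of [v] in the basis formed
    by the columns of [g]. *)
Lemma mem_col_span g v (j : nat) : g \in unitmx ->
  v \in col_span g j <->
  forall i : 'I_n.+1, (j <= i)%N -> (invmx g *m v) i 0 = 0.
Proof.
move=> gU; split.
  move=> gv i le_ji.
  have /matrixP/(_ 0 0) : row i (invmx g) *m v = 0.
    apply: mulmx_col_span0 gv => k lt_kj.
    rewrite -row_mul -col_mulmx mulVmx //; apply/matrixP=> a b; rewrite !mxE.
    by case: eqP => // eik; move: lt_kj; rewrite -eik ltnNge le_ji.
  by rewrite -row_mul !mxE.
move=> vz; rewrite -[v]mul1mx -(mulmxV gU) -mulmxA.
have -> : g *m (invmx g *m v) = \sum_i (invmx g *m v) i 0 *: col i g.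
  apply/matrixP=> i l; rewrite mxE summxE; apply: eq_bigr => m _.
  by rewrite !mxE ord1 mulrC.
apply: memv_suml => i _; have [lt_ij|/vz->] := ltnP i j; last first.
  by rewrite scale0r mem0v.
by apply/memvZ/memv_span/map_f; rewrite mem_filter lt_ij mem_enum.
Qed.

(** Made total by a junk value on singular matrices, so that flags of products
    can be rewritten without carrying proofs of invertibility. *)
Definition flagmx g : flag :=
  if boolP (g \in unitmx) is AltTrue gU then col_flag gU else std_flag.

Lemma flagmxE g (j : 'I_n.+2) : g \in unitmx -> flagmx g j = col_span g j.
Proof.
by move=> gU; rewrite /flagmx; case: {-}_ / boolP => [gU'|/negP//]; rewrite ffunE.
Qed.

Lemma dim_col_span g (j : nat) : g \in unitmx -> (j <= n.+1)%N ->
  \dim (col_span g j) = j.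
Proof.
move=> gU lej; have := flagP (flagmx g) => /andP[/forallP/(_ (inord j))/eqP + _].
by rewrite flagmxE // inordK.
Qed.

Lemma coord_flagE y : coord_flag K y = flagmx (coord_mx K y).
Proof.
apply/val_inj/ffunP => j; rewrite flagmxE ?coord_mx_unit //.
by rewrite /= ffunE.
Qed.

Lemma flag_ext F E : (forall j, F j = E j) -> F = E.
Proof. by move=> FE; apply/val_inj/ffunP. Qed.

(** The flag variety as the set of cosets gB: the two flags have the same
    dimensions, so it is enough that each step of the second lies in the first. *)
Lemma flagmx_eqP g h : g \in unitmx -> h \in unitmx ->
  flagmx g = flagmx h <-> upper (invmx g *m h).
Proof.
move=> gU hU; split=> [e i j lt_ji|up].
  have lt : (j.+1 < n.+2)%N by rewrite ltnS.
  have : col j h \in col_span g (Ordinal lt).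
    rewrite -flagmxE // e flagmxE //.
    by apply/memv_span/map_f; rewrite mem_filter /= leqnn mem_enum.
  by move/(mem_col_span _ _ gU)/(_ i lt_ji); rewrite -col_mulmx mxE.
apply: flag_ext => j; rewrite !flagmxE //.
have lej : (j <= n.+1)%N by rewrite -ltnS.
apply/esym/eqP; rewrite eqEdim !dim_col_span // leqnn andbT.
apply/span_subvP => v /mapP[l]; rewrite mem_filter => /andP[lt_l _] ->.
apply/mem_col_span => // i le_ji; rewrite -col_mulmx mxE up //.
exact: leq_trans lt_l le_ji.
Qed.

Lemma frameP g F : frame g F <-> g \in unitmx /\ F = flagmx g.
Proof.
split=> [fr|[gU ->] j]; last by rewrite flagmxE.
have full : col_span g n.+1 = fullv.
  apply/eqP; rewrite eqEdim subvf /= -[n.+1]/(val (@ord_max n.+1)) -fr.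
  have /andP[/forallP/(_ ord_max)/eqP -> _] := flagP F.
  by rewrite dimvf /dim /= muln1.
have gU : g \in unitmx.
  rewrite -row_free_unit; apply: inj_row_free => v vg0.
  apply/matrixP=> i j; rewrite ord1 !mxE.
  have /matrixP/(_ 0 0) : v *m delta_mx j 0 = 0 :> 'M_1.
    apply: (@mulmx_col_span0 _ _ g n.+1) => [k _|]; last by rewrite full memvf.
    by rewrite -col_mulmx vg0; apply/matrixP=> a b; rewrite !mxE.
  by rewrite -colE !mxE.
by split=> //; apply: flag_ext => j; rewrite flagmxE.
Qed.

(** Column j may be any vector of the step j+1 outside the step j; dimensions
    then force the columns to span. *)
Lemma exists_frame F : exists g, frame g F.
Proof.
have [/forallP dimF /forallP subF] := andP (flagP F).
have lt1 (j : 'I_n.+1) : (j.+1 < n.+2)%N by rewrite ltnS.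
pose F0 (j : 'I_n.+1) := F (inord j); pose F1 (j : 'I_n.+1) := F (inord j.+1).
have pick (j : 'I_n.+1) : exists2 v, v \in F1 j & v \notin F0 j.
  apply/subvPn; apply/negP=> /dimvS; rewrite !(eqP (dimF _)).
  by rewrite !inordK ?ltnn // ltnS ltnW.
pose v j := s2val (cid2 (pick j)); pose g : M := \matrix_(i, j) v j i 0.
have gE j : col j g = v j by apply/matrixP=> a b; rewrite !mxE ord1.
exists g => j; rewrite -[j]inord_val; have := ltn_ord j.
elim: {j}(j : nat) => [_|j IH lt_j].
  rewrite inordK // col_span0; apply/eqP.
  by rewrite -dimv_eq0 (eqP (dimF _)) inordK.
have lt_j1 : (j < n.+1)%N by rewrite -ltnS.
have := col_span_last g (Ordinal lt_j1); rewrite inordK //= => ->.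
rewrite -[X in col_span g X](@inordK n.+1) 1?ltnW // -IH 1?ltnW // gE.
set J := Ordinal _.
have v1 := s2valP (cid2 (pick J)); have v0 := s2valP' (cid2 (pick J)).
rewrite -/(v J) in v1 v0; rewrite /F1 /F0 /= in v1 v0.
apply/esym/eqP; rewrite eqEdim subv_add -memvE v1 andbT.
have -> : (F (inord j) <= F (inord j.+1))%VS.
  by have /forallP/(_ (inord j.+1))/implyP := subF (inord j); apply;
     rewrite !inordK // ltnW.
rewrite (eqP (dimF _)) inordK //= ltnNge; apply/negP=> le.
case/negP: v0; rewrite memvE.
have <- : (F (inord j) + <[v J]>)%VS = F (inord j).
  apply/esym/eqP; rewrite eqEdim addvSl /= (eqP (dimF _)) inordK // ltnW //.
exact: addvSr.
Qed.

End FlagsAsCosets.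

(** * The action of matrices on flags, and relative position *)

Section Action.
Variables (K : fieldType) (n : nat).
Local Notation M := 'M[K]_n.+1.
Local Notation flag := (flag K n).
Local Notation cm := (@coord_mx K n).
Local Notation cf := (@coord_flag K n).
Implicit Types (g h A B : M) (F E : flag) (y z w : 'S_n.+1).

Lemma upper1 : upper (1%:M : M).
Proof. by move=> i j lt; rewrite mxE; case: eqP lt => // ->; rewrite ltnn. Qed.

Lemma upperM A B : upper A -> upper B -> upper (A *m B).
Proof.
move=> uA uB i j lt_ji; rewrite mxE big1 // => k _.
have [lt_ki|le_ik] := ltnP k i; first by rewrite uA // mul0r.
by rewrite uB ?mulr0 //; apply: leq_trans lt_ji le_ik.
Qed.

(** [A] is upper triangular iff it fixes the standard flag, a property
    shared by its inverse. *)
Lemma upper_inv A : A \in unitmx -> upper A -> upper (invmx A).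
Proof.
move=> AU uA; have := @flagmx_eqP K n 1%:M A (unitmx1 _ _) AU.
rewrite invmx1 mul1mx => -[_ /(_ uA)/esym].
by move/flagmx_eqP; rewrite mulmx1; apply => //; apply: unitmx1.
Qed.

Lemma upper_det A : upper A -> \det A = \prod_i A i i.
Proof.
move=> uA; rewrite -det_tr det_trig; last first.
  by apply/is_trig_mxP => i j lt_ij; rewrite mxE uA.
by apply: eq_bigr => i _; rewrite mxE.
Qed.

Lemma upper_diag A i : A \in unitmx -> upper A -> A i i != 0.
Proof.
rewrite unitmxE unitfE => + /upper_det e; rewrite {}e.
by move/prodf_neq0 => /(_ i isT).
Qed.

Lemma upperM_diag A B i : upper A -> upper B -> (A *m B) i i = A i i * B i i.
Proof.
move=> uA uB; rewrite mxE (bigD1 i) //= big1 ?addr0 // => k ne_ki.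
have [lt_ki|le_ik] := ltnP k i; first by rewrite uA // mul0r.
by rewrite uB ?mulr0 // ltn_neqAle eq_sym ne_ki.
Qed.

Definition unitri A : Prop := upper A /\ forall i, A i i = 1.

Lemma unitri_unit A : unitri A -> A \in unitmx.
Proof.
by case=> uA dA; rewrite unitmxE upper_det // big1 ?unitr1 // => i _; apply: dA.
Qed.

Lemma unitri1 : unitri 1%:M.
Proof. by split=> [|i]; [apply: upper1 | rewrite mxE eqxx]. Qed.

Lemma unitriM A B : unitri A -> unitri B -> unitri (A *m B).
Proof.
case=> uA dA [uB dB]; split=> [|i]; first exact: upperM.
by rewrite upperM_diag // dA dB mulr1.
Qed.

Lemma unitri_inv A : unitri A -> unitri (invmx A).
Proof.
move=> tA; have AU := unitri_unit tA; have [uA dA] := tA.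
have uV := upper_inv AU uA; split=> // i.
have := upperM_diag i uA uV; rewrite mulmxV // dA mul1r => <-.
by rewrite mxE eqxx.
Qed.

(** The choice of a frame does not affect [gact] below, by [flagmx_mull]. *)
Definition a_frame F : M := projT1 (cid (exists_frame F)).

Lemma a_frameP F : frame (a_frame F) F.
Proof. exact: projT2 (cid (exists_frame F)). Qed.

Lemma a_frame_unit F : a_frame F \in unitmx.
Proof. by case/frameP: (a_frameP F). Qed.

Lemma flagmxK F : flagmx (a_frame F) = F.
Proof. by case/frameP: (a_frameP F). Qed.

Definition gact g F : flag := flagmx (g *m a_frame F).

Lemma invmxM g h : g \in unitmx -> h \in unitmx ->
  invmx (g *m h) = invmx h *m invmx g.
Proof. by move=> gU hU; apply: (@invrM M). Qed.

Lemma flagmx_mull g h k : g \in unitmx -> h \in unitmx -> k \in unitmx ->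
  flagmx g = flagmx h -> flagmx (k *m g) = flagmx (k *m h).
Proof.
move=> gU hU kU; rewrite !flagmx_eqP ?unitmx_mul ?kU //.
by rewrite invmxM // mulmxA mulmxKV.
Qed.

Lemma gact_flagmx g h : g \in unitmx -> h \in unitmx ->
  gact g (flagmx h) = flagmx (g *m h).
Proof.
move=> gU hU; apply: flagmx_mull => //; first exact: a_frame_unit.
exact: flagmxK.
Qed.

Lemma gactM g h F : g \in unitmx -> h \in unitmx ->
  gact (g *m h) F = gact g (gact h F).
Proof.
move=> gU hU; rewrite -[F]flagmxK; have fU := a_frame_unit F.
by rewrite !gact_flagmx ?unitmx_mul ?gU ?hU // mulmxA.
Qed.

Lemma gact1 F : gact 1%:M F = F.
Proof. by rewrite /gact mul1mx flagmxK. Qed.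

Lemma gactK g F : g \in unitmx -> gact (invmx g) (gact g F) = F.
Proof. by move=> gU; rewrite -gactM ?unitmx_inv // mulVmx // gact1. Qed.

Lemma gactKV g F : g \in unitmx -> gact g (gact (invmx g) F) = F.
Proof. by move=> gU; rewrite -gactM ?unitmx_inv // mulmxV // gact1. Qed.

Lemma gact_inj g F E : g \in unitmx -> gact g F = gact g E -> F = E.
Proof. by move=> gU e; rewrite -(gactK F gU) e gactK. Qed.

Lemma limg_col_span g h j :
  (linfun (mulmx g : 'cV[K]_n.+1 -> 'cV[K]_n.+1) @: col_span h j)%VS
    = col_span (g *m h) j.
Proof.
rewrite /col_span limg_span -map_comp; congr (<<_>>%VS).
by apply: eq_map => i; rewrite /= lfunE /= col_mulmx.
Qed.

Lemma moves_toP g F E : g \in unitmx -> moves_to g F E <-> gact g F = E.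
Proof.
move=> gU; have fU := a_frame_unit F.
have gF j : (linfun (mulmx g : 'cV[K]_n.+1 -> 'cV[K]_n.+1) @: F j)%VS
    = gact g F j.
  by rewrite -{1}[F]flagmxK !flagmxE ?unitmx_mul ?gU ?limg_col_span.
by split=> [mv|<- j]; [apply: flag_ext => j; rewrite -gF mv | rewrite gF].
Qed.

Lemma rel_posP w F E : rel_pos w F E <->
  exists2 g, g \in unitmx & gact g F = std_flag /\ gact g E = cf w.
Proof.
split=> -[g gU [mF mE]]; exists g => //.
  by split; apply/(moves_toP _ _ gU).
by split; apply/(moves_toP _ _ gU).
Qed.

Lemma rel_pos_gact g w F E : g \in unitmx ->
  rel_pos w F E -> rel_pos w (gact g F) (gact g E).
Proof.
move=> gU /rel_posP[h hU [hF hE]]; apply/rel_posP; exists (h *m invmx g).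
  by rewrite unitmx_mul hU unitmx_inv.
by rewrite !gactM ?unitmx_inv ?gactK.
Qed.

Lemma coord_mxM y z : cm y *m cm z = cm (permc y z).
Proof.
apply/matrixP=> i j; rewrite !mxE (bigD1 (z j)) //= !mxE eqxx mulr1 permcE.
by rewrite big1 ?addr0 // => k ne; rewrite !mxE (negPf ne) mulr0.
Qed.

Lemma coord_mx1 : cm 1%g = 1%:M.
Proof. by apply/matrixP=> i j; rewrite !mxE perm1. Qed.

Lemma coord_mxV y : invmx (cm y) = cm y^-1%g.
Proof.
rewrite -[RHS](mulKmx (coord_mx_unit K y)) coord_mxM.
by rewrite /permc mulVg coord_mx1 mulmx1.
Qed.

Lemma gact_coord y z : gact (cm y) (cf z) = cf (permc y z).
Proof. by rewrite !coord_flagE gact_flagmx ?coord_mx_unit // coord_mxM. Qed.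

Lemma rel_pos_coord w y : rel_pos w (cf y) (cf (permc y w)).
Proof.
have -> : cf y = gact (cm y) std_flag.
  by rewrite /std_flag gact_coord /permc mul1g.
rewrite -gact_coord; apply: rel_pos_gact; first exact: coord_mx_unit.
by apply/rel_posP; exists 1%:M; rewrite ?unitmx1 ?gact1.
Qed.

Lemma rel_posV w F E : rel_pos w F E -> rel_pos w^-1%g E F.
Proof.
move/rel_posP=> [g gU [gF gE]].
rewrite -(gactK F gU) -(gactK E gU); apply: rel_pos_gact; rewrite ?unitmx_inv //.
by have := rel_pos_coord w^-1%g w; rewrite gF gE /permc mulVg.
Qed.

Lemma mul_coord_mx A y i j : (A *m cm y) i j = A i (y j).
Proof.
rewrite mxE (bigD1 (y j)) //= mxE eqxx mulr1 big1 ?addr0 // => k ne.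
by rewrite mxE (negPf ne) mulr0.
Qed.

Lemma coord_mx_mul A y i j : (cm y *m A) (y i) j = A i j.
Proof.
rewrite mxE (bigD1 i) //= mxE eqxx mul1r big1 ?addr0 // => k ne.
by rewrite mxE (inj_eq perm_inj) eq_sym (negPf ne) mul0r.
Qed.

(** The stabiliser of F(y) is the conjugate by y of the upper triangular group,
    and conjugation by y permutes the entries. *)
Lemma stab_coordP A y : A \in unitmx -> gact A (cf y) = cf y <->
  forall i j : 'I_n.+1, (j < i)%N -> A (y i) (y j) = 0.
Proof.
move=> AU; have yU := coord_mx_unit K y; have VU := coord_mx_unit K y^-1%g.
rewrite coord_flagE gact_flagmx //.
have e i j : (invmx (cm y) *m (A *m cm y)) i j = A (y i) (y j).
  by rewrite coord_mxV -{1}(permK y i) coord_mx_mul mul_coord_mx.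
split=> [/esym/flagmx_eqP|up].
  by rewrite unitmx_mul AU yU => /(_ isT isT) up i j /up; rewrite e.
by apply/esym/flagmx_eqP; rewrite ?unitmx_mul ?AU // => i j lt; rewrite e up.
Qed.

Lemma gact_unitri_std A : unitri A -> gact A std_flag = std_flag.
Proof.
move=> tA; apply/stab_coordP; first exact: unitri_unit.
by move=> i j lt_ji; rewrite !perm1; case: tA => + _; apply.
Qed.

End Action.

(** * Paths of flags along a reduced word *)

Section Words.
Variable n : nat.
Implicit Types (a b : seq 'I_n) (i : 'I_n) (y z w : 'S_n.+1) (p q : 'I_n.+1).

Definition lo (i : 'I_n) : 'I_n.+1 := inord i.
Definition hi (i : 'I_n) : 'I_n.+1 := inord i.+1.

Lemma loE i : lo i = i :> nat.
Proof. by rewrite inordK // ltnW // ltnS. Qed.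

Lemma hiE i : hi i = i.+1 :> nat.
Proof. by rewrite inordK // ltnS. Qed.

Lemma lt_lo_hi i : (lo i < hi i)%N.
Proof. by rewrite loE hiE. Qed.

Lemma simple_tr_lo i : simple_tr i (lo i) = hi i.
Proof. exact: tpermL. Qed.

Lemma simple_tr_hi i : simple_tr i (hi i) = lo i.
Proof. exact: tpermR. Qed.

Lemma simple_trV i : (simple_tr i)^-1%g = simple_tr i.
Proof. exact: tpermV. Qed.

Lemma simple_trK i p : simple_tr i (simple_tr i p) = p.
Proof. by rewrite -{1}simple_trV permK. Qed.

Lemma simple_tr_flip i p q : (p < q)%N ->
  (simple_tr i q < simple_tr i p)%N -> p = lo i /\ q = hi i.
Proof.
move=> lt_pq; rewrite /simple_tr -/(lo i) -/(hi i); have loi := loE i.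
have hii := hiE i.
case: tpermP => [eq|eq|/eqP qlo /eqP qhi]; case: tpermP => [ep|ep|/eqP plo /eqP phi] //.
- by move: lt_pq; rewrite ep eq ltnn.
- by move: lt_pq; rewrite ep eq loi hii; lia.
- have : val p != i by apply: contra plo; rewrite -loi => /eqP/val_inj->.
  by move: lt_pq; rewrite eq loi hii; lia.
- by rewrite ltnn.
- have : val p != i by apply: contra plo; rewrite -loi => /eqP/val_inj->.
  by move: lt_pq; rewrite eq loi hii; lia.
- have : val q != i.+1 by apply: contra qhi; rewrite -hii => /eqP/val_inj->.
  by move: lt_pq; rewrite ep loi hii; lia.
- have : val q != i.+1 by apply: contra qhi; rewrite -hii => /eqP/val_inj->.
  by move: lt_pq; rewrite ep loi hii; lia.
- by move=> lt_qp; move: lt_pq; rewrite ltnNge ltnW.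
Qed.

Lemma permcA y z w : permc y (permc z w) = permc (permc y z) w.
Proof. by rewrite /permc mulgA. Qed.

Lemma word_perm_cat a b : word_perm (a ++ b) = permc (word_perm a) (word_perm b).
Proof.
elim: a => [|i a IH] /=; first by rewrite /permc mulg1.
by rewrite IH permcA.
Qed.

Lemma word_perm_rcons a i :
  word_perm (rcons a i) = permc (word_perm a) (simple_tr i).
Proof. by rewrite -cats1 word_perm_cat /= /permc mul1g. Qed.

Lemma word_perm_rev a : word_perm (rev a) = (word_perm a)^-1%g.
Proof.
elim: a => [|i a IH]; first by rewrite invg1.
by rewrite rev_cons word_perm_rcons IH /= /permc invMg simple_trV.
Qed.

Definition reduced a := reduced_expr (word_perm a) a.

Lemma reduced_rev a : reduced a -> reduced (rev a).
Proof.
case=> _ minA; split=> // b; rewrite word_perm_rev => eb.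
by rewrite size_rev -(size_rev b) minA // word_perm_rev eb invgK.
Qed.

Lemma reduced_rcons a i : reduced (rcons a i) -> reduced a.
Proof.
case=> _ minA; split=> // b eb.
have := minA (rcons b i); rewrite !word_perm_rcons eb !size_rcons ltnS.
by apply.
Qed.

(** The strands that leave from [lo i] and [hi i] have crossed at some letter of
    the word; deleting that letter has the effect of a further crossing at i. *)
Lemma exchange a i : (word_perm a (hi i) < word_perm a (lo i))%N ->
  exists2 b, word_perm b = permc (word_perm a) (simple_tr i)
           & (size b).+1 = size a.
Proof.
elim: a => [|j a IH]; first by rewrite !perm1 ltnNge ltnW // lt_lo_hi.
rewrite /= !permcE; set u := word_perm a.
have [lt_u|] := ltnP (u (hi i)) (u (lo i)).
  have [b eb <-] := IH lt_u; exists (j :: b) => //=.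
  by rewrite eb permcA.
rewrite leq_eqVlt => /orP[/eqP/val_inj/perm_inj e|lt_u flip].
  by have := lt_lo_hi i; rewrite e ltnn.
have [eu1 eu2] := simple_tr_flip lt_u flip; exists a => //.
apply/permP=> p; rewrite !permcE -/u.
have [->|/eqP plo] := p =P lo i; first by rewrite simple_tr_lo eu2 simple_tr_hi.
have [->|/eqP phi] := p =P hi i; first by rewrite simple_tr_hi eu1 simple_tr_lo.
rewrite [simple_tr i p]tpermD 1?eq_sym // tpermD // -/(lo j) -/(hi j) -?eu1 -?eu2.
  by rewrite (inj_eq perm_inj) eq_sym.
by rewrite (inj_eq perm_inj) eq_sym.
Qed.

(** Otherwise the exchange lemma gives a shorter word for the same permutation. *)
Lemma reduced_ascent a i : reduced (rcons a i) ->
  (word_perm a (lo i) < word_perm a (hi i))%N.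
Proof.
case=> _ minA; rewrite ltnNge leq_eqVlt; apply/negP=> /orP[|].
  move/eqP/val_inj/perm_inj=> e; have := lt_lo_hi i; rewrite e ltnn //.
case/exchange=> b eb sb; have := minA b; rewrite word_perm_rcons size_rcons => /(_ eb).
by lia.
Qed.

(** Along a reduced word each letter inverts a new pair, by [reduced_ascent], and
    no inversion is ever undone. *)
Lemma reduced_prefix_noninv a p q j : reduced a -> (p < q)%N ->
  ((word_perm a)^-1%g p < (word_perm a)^-1%g q)%N -> (j <= size a)%N ->
  ((word_perm (take j a))^-1%g p < (word_perm (take j a))^-1%g q)%N.
Proof.
move=> + lt_pq; elim/last_ind: a => [|a i IH] // ra lt_a.
rewrite size_rcons leq_eqVlt => /orP[/eqP->|].
  by rewrite -(size_rcons a i) take_size.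
rewrite ltnS => le_j; rewrite -cats1 takel_cat //.
apply: IH le_j; first exact: reduced_rcons ra.
move: lt_a; rewrite word_perm_rcons /permc invMg !permM simple_trV.
set p' := _ p; set q' := _ q => lt'.
rewrite ltnNge leq_eqVlt; apply/negP=> /orP[|lt_qp].
  by move/eqP/val_inj/perm_inj=> e; move: lt_pq; rewrite e ltnn.
have [eq ep] := simple_tr_flip lt_qp lt'.
have := reduced_ascent ra; rewrite -eq -ep !permKV.
by rewrite ltnNge ltnW.
Qed.

End Words.

Section ReducedPaths.
Variables (K : fieldType) (n : nat).
Local Notation M := 'M[K]_n.+1.
Local Notation flag := (flag K n).
Local Notation cm := (@coord_mx K n).
Local Notation cf := (@coord_flag K n).

Implicit Types (p q : 'I_n.+1) (a b : seq 'I_n) (y : 'S_n.+1).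
Implicit Types (f : nat -> flag) (t : K) (E : flag).

Definition elem (p q : 'I_n.+1) (t : K) : M := 1%:M + t *: delta_mx p q.

Lemma elem_mul p q t (A : M) i j :
  (elem p q t *m A) i j = A i j + (if i == p then t * A q j else 0).
Proof.
rewrite mulmxDl mul1mx -scalemxAl mxE; congr (_ + _); rewrite !mxE.
rewrite (bigD1 q) //= big1 => [|k /negPf ne]; rewrite mxE.
  by rewrite eqxx andbT addr0; case: eqP; rewrite ?mul1r ?mul0r ?mulr0.
by rewrite ne andbF mul0r.
Qed.

Lemma elemE p q t i j :
  elem p q t i j = (i == j)%:R + (if (i == p) && (j == q) then t else 0).
Proof. by rewrite !mxE; case: ifP; rewrite ?mulr1 ?mulr0. Qed.

Lemma unitri_elem p q t : (p < q)%N -> unitri (elem p q t).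
Proof.
move=> lt_pq; split=> [i j lt_ji|i]; rewrite elemE.
  rewrite ifF; last by apply/negP=> /andP[/eqP ep /eqP eq]; move: lt_ji lt_pq;
    rewrite ep eq => /ltnW; rewrite leqNgt => /negPf ->.
  by rewrite addr0; case: eqP lt_ji => // ->; rewrite ltnn.
rewrite eqxx ifF ?addr0 //; apply/negP=> /andP[/eqP ep /eqP eq].
by move: lt_pq; rewrite -ep -eq ltnn.
Qed.

Lemma elemV p q t : p != q -> elem p q (- t) *m elem p q t = 1%:M.
Proof.
move=> /negPf ne; apply/matrixP=> i j; rewrite elem_mul !elemE mxE.
rewrite [q == p]eq_sym ne /= addr0 [q == j]eq_sym -addrA.
case: (i == p) => //=; last by rewrite !addr0.
by case: (j == q); rewrite ?mulr1 ?mulr0 ?addr0 ?subrr ?addr0 //.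
Qed.

Lemma coord_mx_elem y p q t :
  cm y *m elem p q t = elem (y p) (y q) t *m cm y.
Proof.
apply/matrixP=> i j; rewrite mul_coord_mx -(permKV y i) coord_mx_mul !elemE.
by rewrite !(inj_eq perm_inj).
Qed.

(** From B s_i B = U_i s_i B, with U_i the root subgroup of s_i: the entry (i, i+1)
    of an upper triangular matrix can be cleared by an element of U_i, and s_i
    normalises the upper triangular matrices without that entry. *)
Lemma rel_pos_simple (i : 'I_n) (h : M) E : h \in unitmx ->
  rel_pos (simple_tr i) (flagmx h) E ->
  exists t, E = flagmx (h *m elem (lo i) (hi i) t *m cm (simple_tr i)).
Proof.
move=> hU /rel_posP[g gU [gh gE]]; set s := simple_tr i.
have sU := coord_mx_unit K s.
have ghU : g *m h \in unitmx by rewrite unitmx_mul gU.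
pose c := invmx (g *m h); have cU : c \in unitmx by rewrite unitmx_inv.
have uc : upper c.
  move: gh; rewrite gact_flagmx // /std_flag coord_flagE coord_mx1.
  by move/flagmx_eqP; rewrite mulmx1; apply; rewrite ?unitmx1.
pose t := c (lo i) (hi i) / c (hi i) (hi i); exists t.
have eU : elem (lo i) (hi i) t \in unitmx.
  by apply/unitri_unit/unitri_elem/lt_lo_hi.
have -> : E = flagmx (h *m (c *m cm s)).
  rewrite -(gactK E gU) gE coord_flagE gact_flagmx ?unitmx_inv // mulmxA.
  by congr (flagmx (_ *m _)); rewrite /c invmxM // mulmxA mulmxV // mul1mx.
rewrite -mulmxA; apply: flagmx_mull; rewrite ?unitmx_mul ?cU ?eU //.
apply/esym/flagmx_eqP; rewrite ?unitmx_mul ?cU ?eU //.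
have ne : lo i != hi i by apply: contraTneq (lt_lo_hi i) => ->; rewrite ltnn.
have Ve : invmx (elem (lo i) (hi i) t) = elem (lo i) (hi i) (- t).
  by rewrite -[LHS]mul1mx -(elemV t ne) mulmxK.
rewrite invmxM // Ve coord_mxV simple_trV.
pose A := elem (lo i) (hi i) (- t) *m c.
have uA : upper A.
  by apply: upperM uc; case: (unitri_elem (- t) (lt_lo_hi i)).
move=> k j lt_jk; rewrite -mulmxA (mulmxA (elem _ _ _)) -/A.
rewrite -{1}(simple_trK i k) coord_mx_mul mul_coord_mx.
have [/uA//|le] := ltnP (s j) (s k).
have lt : (s k < s j)%N.
  rewrite ltn_neqAle le andbT; apply: contraTneq lt_jk => /val_inj/perm_inj->.
  by rewrite ltnn.
have [-> ->] := simple_tr_flip lt_jk lt; rewrite /s simple_tr_lo simple_tr_hi.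
rewrite /A elem_mul eqxx /t mulNr divfK ?addrN //.
exact: upper_diag.
Qed.

Definition steps (a : seq 'I_n) (f : nat -> flag) : Prop :=
  forall j, (j < size a)%N ->
    rel_pos (nth 1%g (map (@simple_tr n) a) j) (f j) (f j.+1).

Lemma steps_ext a f f' : (forall j, (j <= size a)%N -> f j = f' j) ->
  steps a f -> steps a f'.
Proof. by move=> ef st j lt; rewrite -(ef j (ltnW lt)) -(ef j.+1 lt); apply: st. Qed.

Lemma steps_cat a b f :
  steps (a ++ b) f <-> steps a f /\ steps b (fun j => f (size a + j)%N).
Proof.
rewrite /steps size_cat map_cat; split=> [st|[sa sb] j lt].
  split=> j lt.
    by have := st j; rewrite nth_cat size_map lt; apply; rewrite ltn_addr.
  have := st (size a + j)%N; rewrite nth_cat size_map (ltnNge _ (size a)) leq_addr addKn.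
  by rewrite addnS; apply; rewrite ltn_add2l.
rewrite nth_cat size_map; have [/sa//|le] := ltnP j (size a).
have := sb (j - size a)%N; rewrite addnS subnKC //; apply.
by rewrite ltn_subLR.
Qed.

Lemma steps_rev a f : steps a f -> steps (rev a) (fun j => f (size a - j)%N).
Proof.
move=> st j; rewrite size_rev => lt; rewrite map_rev nth_rev size_map //.
have := st (size a - j.+1)%N; rewrite -subSn // subSS => /(_ _)/rel_posV.
rewrite (nth_map (tnth (in_tuple a) (Ordinal lt))).
  by rewrite simple_trV; apply; lia.
by lia.
Qed.

Lemma steps_gact a g f : g \in unitmx -> steps a f -> steps a (gact g \o f).
Proof. by move=> gU st j lt; apply: rel_pos_gact => //; apply: st. Qed.

Definition coord_path (a : seq 'I_n) (j : nat) : flag :=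
  cf (word_perm (take j a)).

Lemma steps_coord a : steps a (coord_path a).
Proof.
move=> j lt; rewrite /coord_path (take_nth (tnth (in_tuple a) (Ordinal lt))) //.
rewrite word_perm_rcons (nth_map (tnth (in_tuple a) (Ordinal lt))) //.
exact: rel_pos_coord.
Qed.

(** Let the word a be followed by a letter i, and let y be the permutation of a.
    The last flag moves in the root subgroup of the pair (y(lo i), y(hi i)). This
    subgroup is upper triangular because the longer word is reduced, and it fixes
    the earlier coordinate flags because the pair is not yet inverted there; so
    its element can be absorbed into u. *)
Lemma reduced_path a f : reduced a -> f 0%N = std_flag -> steps a f ->
  exists2 u, unitri u &
    forall j, (j <= size a)%N -> f j = gact u (coord_path a j).
Proof.
elim/last_ind: a => [|a i IH] ra f0 st.
  exists 1%:M; first exact: unitri1.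
  by move=> j; rewrite leqn0 => /eqP->; rewrite f0 gact1 /coord_path take_oversize.
have sa : steps a f by move: (st); rewrite -cats1 => /steps_cat[].
have [u tu fu] := IH (reduced_rcons ra) f0 sa.
have asc := reduced_ascent ra; set y := word_perm a in asc.
have uU := unitri_unit tu; have yU := coord_mx_unit K y.
have sU := coord_mx_unit K (simple_tr i).
have last : rel_pos (simple_tr i) (flagmx (u *m cm y)) (f (size a).+1).
  have := st (size a); rewrite size_rcons => /(_ (leqnn _)).
  rewrite map_rcons nth_rcons size_map ltnn eqxx fu // /coord_path take_size.
  by rewrite coord_flagE gact_flagmx.
have uyU : u *m cm y \in unitmx by rewrite unitmx_mul uU.
have [t ft] := rel_pos_simple uyU last.
pose e := elem (y (lo i)) (y (hi i)) t.
have te : unitri e by apply: unitri_elem.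
have eU := unitri_unit te.
exists (u *m e); first exact: unitriM.
move=> j; rewrite size_rcons leq_eqVlt => /orP[/eqP->|].
  rewrite /coord_path -(size_rcons a i) take_size size_rcons ft coord_flagE.
  rewrite gact_flagmx ?unitmx_mul ?uU ?coord_mx_unit // word_perm_rcons.
  by rewrite -coord_mxM /e -!mulmxA (mulmxA (cm y)) coord_mx_elem -mulmxA.
rewrite ltnS => le_j; rewrite fu // gactM //; congr (gact u _).
rewrite /coord_path -cats1 takel_cat //; apply/esym/stab_coordP => // k l lt_lk.
rewrite elemE (inj_eq perm_inj) ifF; last first.
  apply/negP=> /andP[/eqP ek /eqP el].
  have := reduced_prefix_noninv (reduced_rcons ra) asc; rewrite -/y !permK lt_lo_hi.
  move=> /(_ _ isT le_j); rewrite -ek -el !permK.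
  by rewrite ltnNge ltnW.
by rewrite addr0; case: eqP lt_lk => // ->; rewrite ltnn.
Qed.

End ReducedPaths.

(** * Unitriangular matrices acting on pairs of coordinate flags *)

Section Unipotent.
Variables (K : fieldType) (n : nat).
Local Notation M := 'M[K]_n.+1.
Local Notation flag := (flag K n).
Local Notation cm := (@coord_mx K n).
Local Notation cf := (@coord_flag K n).
Implicit Types (A B N : M) (p q : 'I_n.+1) (y x : 'S_n.+1) (E : flag).

Lemma w0E p : w0 p = rev_ord p.
Proof. by rewrite permE. Qed.

Lemma w0K p : w0 (w0 p) = p.
Proof. by rewrite !w0E rev_ordK. Qed.

Lemma w0V : (w0^-1 = w0 :> 'S_n.+1)%g.
Proof. by apply/permP=> p; rewrite -{1}(w0K p) permK. Qed.

Lemma permc_w0K y : permc (permc y w0) w0 = y.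
Proof. by apply/permP=> p; rewrite !permcE w0K. Qed.

Lemma ltn_w0 p q : (w0 p < w0 q)%N = (q < p)%N.
Proof. by rewrite !w0E /=; have := ltn_ord p; have := ltn_ord q; lia. Qed.

(** The common stabiliser of F(y1) and F(y2) among the unitriangular matrices is
    then trivial: for all p < q, the root subgroup (p, q) moves F(y1)
    or F(y2). *)
Definition separating y1 y2 : Prop := forall p q, (p < q)%N ->
  (y1^-1%g q < y1^-1%g p)%N || (y2^-1%g q < y2^-1%g p)%N.

Lemma separating_w0 : separating w0 w0.
Proof. by move=> p q lt; rewrite w0V !ltn_w0 lt. Qed.

Lemma separating_opp x : separating x (permc x w0).
Proof.
move=> p q lt; rewrite /permc invMg w0V !permM ltn_w0 -neq_ltn.
by apply: contraTneq lt => /val_inj/perm_inj ->; rewrite ltnn.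
Qed.

Lemma unitri_fix2 A y1 y2 : separating y1 y2 -> unitri A ->
  gact A (cf y1) = cf y1 -> gact A (cf y2) = cf y2 -> A = 1%:M.
Proof.
move=> sep tA; have AU := unitri_unit tA; have [uA dA] := tA.
move=> /(stab_coordP _ AU) z1 /(stab_coordP _ AU) z2.
apply/matrixP=> p q; rewrite mxE; case: (ltngtP p q) => [lt|lt|/val_inj->].
- rewrite (_ : (p == q) = false); last by apply: contraTF lt => /eqP->; rewrite ltnn.
  case/orP: (sep _ _ lt) => [/z1|/z2]; rewrite !permKV //.
- rewrite (_ : (p == q) = false); last by apply: contraTF lt => /eqP->; rewrite ltnn.
  exact: uA.
- by rewrite eqxx dA.
Qed.

Lemma unitri_uniq A B y1 y2 E1 E2 : separating y1 y2 -> unitri A -> unitri B ->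
  gact A E1 = cf y1 -> gact A E2 = cf y2 ->
  gact B E1 = cf y1 -> gact B E2 = cf y2 -> A = B.
Proof.
move=> sep tA tB A1 A2 B1 B2; have AU := unitri_unit tA.
have BU := unitri_unit tB.
have: A *m invmx B = 1%:M.
  apply: (unitri_fix2 sep); first exact/unitriM/unitri_inv.
  - by rewrite -{1}B1 gactM ?unitmx_inv // gactK.
  - by rewrite -{1}B2 gactM ?unitmx_inv // gactK.
by move/(congr1 (mulmx^~ B)); rewrite mulmxKV // mul1mx.
Qed.

(** If g moves the pair (E, std) to (std, ant), then w0 g moves E to ant and fixes
    std. So w0 g is upper triangular, and its diagonal can be normalised since
    diagonal matrices fix all coordinate flags. *)
Lemma transverse_std E : transverse E std_flag ->
  exists2 A, unitri A & gact A E = ant_flag.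
Proof.
move=> /rel_posP[g gU [gE gs]]; pose w := @w0 n; have wU := coord_mx_unit K w.
pose T := cm w *m g; have TU : T \in unitmx by rewrite unitmx_mul wU.
have TE : gact T E = ant_flag by rewrite gactM // gE gact_coord /permc mul1g.
have uT : upper T.
  have : gact T std_flag = std_flag.
    by rewrite gactM // gs gact_coord; congr cf; apply/permP=> p; rewrite permcE w0K perm1.
  by move/(stab_coordP _ TU)=> z i j /z; rewrite !perm1.
pose D : M := diag_mx (\row_i (T i i)^-1).
have DU : D \in unitmx.
  rewrite unitmxE det_diag unitfE; apply/prodf_neq0=> i _.
  rewrite mxE invr_eq0; exact: upper_diag.
have dD : upper D.
  by move=> i j lt; rewrite !mxE; case: eqP lt => [->|]; rewrite ?ltnn.
exists (D *m T).
  split=> [|i]; first exact: upperM.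
  rewrite upperM_diag // [D i i]mxE mxE eqxx mulVf //.
  exact: upper_diag.
rewrite gactM // TE; apply/stab_coordP => // i j lt; rewrite !mxE.
by rewrite (inj_eq perm_inj); case: eqP lt => [->|]; rewrite ?ltnn.
Qed.

(** The pairs p < q split into those whose root subgroup fixes F(x) and those
    whose root subgroup fixes F(x w0). Entries of the first
    kind are cleared by left multiplication, in order of increasing height q - p. *)
Lemma unitri_factor N x : unitri N ->
  exists A B, [/\ unitri A, unitri B, N = A *m B,
    gact A (cf x) = cf x & gact B (cf (permc x w0)) = cf (permc x w0)].
Proof.
move=> tN; pose pos p q := (x^-1%g p < x^-1%g q)%N.
suff [A [tA Ax ANz]] : exists A, [/\ unitri A, gact A (cf x) = cf x &
    forall p q, (p < q)%N -> pos p q -> (A *m N) p q = 0].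
  have AU := unitri_unit tA.
  have tAN : unitri (A *m N) by apply: unitriM.
  exists (invmx A), (A *m N); split=> //; first exact: unitri_inv.
  - by rewrite mulKmx.
  - by rewrite -{1}Ax gactK.
  apply/stab_coordP; first exact: unitri_unit.
  move=> i j lt; rewrite !permcE; set p := x _; set q := x _.
  have [lt_pq|le_qp] := ltnP p q.
    by apply: ANz; rewrite // /pos !permK ltn_w0.
  case: tAN => + _; apply; rewrite ltn_neqAle le_qp andbT.
  by apply: contraTneq lt => /val_inj/perm_inj/perm_inj->; rewrite ltnn.
suff key h : exists A, [/\ unitri A, gact A (cf x) = cf x &
    forall p q, (p < q)%N -> (q < p + h)%N -> pos p q -> (A *m N) p q = 0].
  have [A [tA Ax Az]] := key n.+1; exists A; split=> // p q lt_pq.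
  by apply: Az => //; rewrite (leq_trans (ltn_ord q)) // leq_addl.
elim: h => [|h [A [tA Ax Az]]].
  exists 1%:M; split; [exact: unitri1 | exact: gact1 |].
  by move=> p q lt; rewrite addn0 ltnNge ltnW.
have AU := unitri_unit tA; set N' := A *m N in Az.
have tN' : unitri N' by apply: unitriM.
have [uN' dN'] := tN'.
(* P clears the entries of the first kind at height h and leaves the entries of
   smaller height as they are. *)
pose root p q := [&& (p < q)%N, (q == p + h :> nat)%N & pos p q].
pose P : M := \matrix_(p, q)
  ((p == q)%:R - (if root p q then N' p q else 0)).
have tP : unitri P.
  split=> [p q lt|p]; rewrite mxE /root; last by rewrite eqxx ltnn subr0.
  rewrite ltnNge (ltnW lt) subr0 (_ : (p == q) = false) //.
  by apply: contraTF lt => /eqP->; rewrite ltnn.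
exists (P *m A); split; first exact: unitriM.
  rewrite gactM ?Ax; try exact: unitri_unit.
  apply/stab_coordP; first exact: unitri_unit.
  move=> i j lt; rewrite mxE /root /pos !permK (ltnNge i j) (ltnW lt) !andbF subr0.
  by rewrite (inj_eq perm_inj); case: eqP lt => // ->; rewrite ltnn.
move=> p q lt_pq; rewrite addnS ltnS => le_q pos_pq.
have -> : (P *m A *m N) p q = N' p q - (if root p q then N' p q else 0).
  rewrite -mulmxA -/N' mxE (bigD1 p) //= [P p p]mxE eqxx {1}/root ltnn subr0 mul1r.
  congr (_ + _); have ne_qp : q != p.
    by apply: contraTneq lt_pq => ->; rewrite ltnn.
  rewrite (bigD1 q) //= [P p q]mxE [p == q]eq_sym (negPf ne_qp) sub0r dN' mulr1.
  rewrite big1 ?addr0 // => k /andP[ne_kp ne_kq].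
  rewrite [P p k]mxE [p == k]eq_sym (negPf ne_kp) sub0r.
  case: ifP => [/and3P[_ /eqP ek _]|_]; last by rewrite oppr0 mul0r.
  by rewrite uN' ?mulr0 // ltn_neqAle eq_sym ne_kq ek.
rewrite /root lt_pq pos_pq andbT /=; case: eqP => [|/eqP ne]; first by rewrite subrr.
by rewrite subr0; apply: Az => //; rewrite ltn_neqAle ne.
Qed.

(** If A^-1 B = P Q as in [unitri_factor], then C = A P = B Q^-1 serves. *)
Lemma unitri_common A B x : unitri A -> unitri B ->
  exists2 C, unitri C & gact C (cf x) = gact A (cf x) /\
    gact C (cf (permc x w0)) = gact B (cf (permc x w0)).
Proof.
move=> tA tB; have AU := unitri_unit tA.
have [P [Q [tP tQ e Px Qx]]] := unitri_factor x (unitriM (unitri_inv tA) tB).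
have PU := unitri_unit tP; have QU := unitri_unit tQ.
exists (A *m P); first exact: unitriM.
split; first by rewrite gactM // Px.
have -> : B = A *m P *m Q by rewrite -mulmxA -e mulmxA mulmxV // mul1mx.
by rewrite (gactM _ _ QU) ?Qx // unitmx_mul AU.
Qed.

End Unipotent.

(** * Plücker forms and regular functions at a point *)

Section PluckerForms.
Variables (K : fieldType) (n : nat).
Local Notation M := 'M[K]_n.+1.
Implicit Types (g : M) (S : {set 'I_n.+1}).

Lemma inord_ltn (S : {set 'I_n.+1}) (b : 'I_#|S|) : (inord b : 'I_n.+1) = b :> nat.
Proof.
by rewrite inordK // (leq_trans (ltn_ord b)) // -[X in (_ <= X)%N]card_ord max_card.
Qed.

Lemma plucker_upper g (T : M) S : upper T ->
  plucker (g *m T) S =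
    plucker g S * \det (\matrix_(a < #|S|, b < #|S|) T (inord a) (inord b)).
Proof.
move=> uT; rewrite /plucker -det_mulmx; congr (\det _); apply/matrixP=> a b.
rewrite !mxE; have leS : (#|S| <= n.+1)%N.
  by rewrite -[X in (_ <= X)%N]card_ord max_card.
under [RHS]eq_bigr do rewrite !mxE.
rewrite (big_ord_widen n.+1
  (fun c => g (enum_val a) (inord c) * T (inord c) (inord b)) leS).
rewrite [RHS]big_mkcond /=; apply: eq_bigr => c _.
rewrite inord_val; case: ltnP => // le; rewrite uT ?mulr0 // inord_ltn.
exact: leq_trans (ltn_ord b) le.
Qed.

(** Two frames of the same flag differ by an upper triangular matrix, so all
    Plücker coordinates of a given size are scaled by one leading minor. *)
Lemma plucker_frames g h F : frame g F -> frame h F ->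
  exists c : nat -> K, (forall S, c #|S| != 0) /\
    forall S, plucker h S = c #|S| * plucker g S.
Proof.
move=> /frameP[gU gF] /frameP[hU hF].
have [T [TU uT ->]] : exists T, [/\ T \in unitmx, upper T & h = g *m T].
  exists (invmx g *m h); rewrite unitmx_mul unitmx_inv gU mulKVmx //; split=> //.
  by apply/flagmx_eqP; rewrite -?gF.
exists (fun m => \det (\matrix_(a < m, b < m) T (inord a) (inord b))).
split=> S; last by rewrite mulrC -plucker_upper.
set L := \matrix_(_, _) _.
rewrite -det_tr det_trig; last first.
  by apply/is_trig_mxP => a b lt; rewrite !mxE uT // !inord_ltn.
by apply/prodf_neq0 => a _; rewrite !mxE upper_diag.
Qed.

Variable I : finType.
Local Notation pt := (pt K n I).
Local Notation N := #|pcoord n I|.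
Implicit Types (x y : pt) (P Q : plpoly K n I) (d : I -> nat -> nat).
Implicit Types (h : I -> M).

Definition nearby_frames y (i : I) : M := a_frame (y i).

Lemma nearby_framesP y : frames (nearby_frames y) y.
Proof. by move=> i; apply: a_frameP. Qed.

(** The scalar depends on the multidegree only, so quotients of forms of equal
    multidegree are well defined on flags. *)
Lemma pleval_frames x d h h' : frames h x -> frames h' x ->
  exists2 c : K, c != 0 & forall P, multihomog d P ->
    pleval P h' = c * pleval P h.
Proof.
move=> hx h'x.
have /choice[c cP] i := plucker_frames (hx i) (h'x i).
pose card_of (t : 'I_N) := #|(enum_val t).2|.
pose idx (t : 'I_N) := (enum_val t).1.
have lt_card (t : 'I_N) : (card_of t < n.+2)%N.
  by rewrite ltnS -[X in (_ <= X)%N]card_ord max_card.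
have ex (j : 'I_n.+2) : exists S : {set 'I_n.+1}, #|S| = j.
  have [S _ <-] : exists2 S : {set 'I_n.+1}, true & #|S| = j; last by exists S.
  have lej : (j <= #|[set: 'I_n.+1]|)%N by rewrite cardsT card_ord -ltnS.
  by have /set0Pn[S] : [set S : {set 'I_n.+1} | S \subset [set: 'I_n.+1] & #|S| == j] != set0
    ; [rewrite -card_gt0 cards_draws bin_gt0 | rewrite inE => /andP[_ /eqP]; exists S].
exists (\prod_(i : I) \prod_(j < n.+2) c i j ^+ d i j).
  apply/prodf_neq0=> i _; apply/prodf_neq0=> j _; apply: expf_neq0.
  by have [S <-] := ex j; case: (cP i) => + _; apply.
move=> P hP; rewrite /pleval !mevalE mulr_sumr; apply: eq_big_seq => m mP.
rewrite mulrCA; congr (_ * _).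
transitivity (\prod_(t < N) (c (idx t) (card_of t) ^+ m t *
    plucker (h (enum_val t).1) (enum_val t).2 ^+ m t)).
  apply: eq_bigr => t _; rewrite -exprMn; congr (_ ^+ _).
  by have [_ ->] := cP (enum_val t).1.
rewrite big_split /=; congr (_ * _).
rewrite (partition_big idx xpredT) //=; apply: eq_bigr => i _.
rewrite (partition_big (fun t => inord (card_of t) : 'I_n.+2) xpredT) //=.
apply: eq_bigr => j _; rewrite -(hP m mP i j) -prodrXr.
rewrite (eq_bigl (fun t : 'I_N => (idx t == i) && (card_of t == j))); last first.
  by move=> t; congr (_ && _); rewrite -val_eqE /= inordK.
by apply: eq_bigr => t /andP[/eqP-> /eqP->].
Qed.

Lemma nonvanishingE x d h Q : frames h x -> multihomog d Q ->
  nonvanishing Q x <-> pleval Q h != 0.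
Proof.
move=> hx hQ; split=> [[h' h'x]|]; last by exists h.
by have [c c0 ->] := pleval_frames d hx h'x; rewrite // mulf_eq0 negb_or => /andP[].
Qed.

Lemma multihomog_const c : multihomog (fun _ _ => 0%N) (c%:MP : plpoly K n I).
Proof.
move=> m; rewrite msuppC; case: ifP => // _; rewrite inE => /eqP-> i j.
by rewrite big1 // => t _; rewrite mnm0E.
Qed.

Lemma multihomogD d P Q : multihomog d P -> multihomog d Q ->
  multihomog d (P + Q).
Proof.
by move=> hP hQ m /msuppD_le; rewrite mem_cat => /orP[/hP|/hQ].
Qed.

Lemma multihomogM d e P Q : multihomog d P -> multihomog e Q ->
  multihomog (fun i j => (d i j + e i j)%N) (P * Q).
Proof.
move=> hP hQ m /msuppM_le/allpairsP[[m1 m2] /= [/hP h1 /hQ h2 ->]] i j.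
rewrite -h1 -h2 -big_split; apply: eq_bigr => t _; exact: mnmDE.
Qed.

Definition coord_poly i S : plpoly K n I := 'X_(enum_rank ((i, S) : pcoord n I)).

Lemma multihomog_coord i S :
  multihomog (fun i' j => ((i' == i) && (j == #|S|))%N : nat) (coord_poly i S).
Proof.
move=> m; rewrite msuppX inE => /eqP-> i' j.
under eq_bigr do rewrite mnm1E.
case: (boolP ((i' == i) && (j == #|S|))) => [/andP[/eqP-> /eqP->]|ne].
  rewrite (bigD1 (enum_rank ((i, S) : pcoord n I))) /= ?enum_rankK ?eqxx //.
  by rewrite big1 // => t /andP[_ /negPf]; rewrite eq_sym => ->.
rewrite big1 // => t /andP[/eqP e1 /eqP e2]; case: eqP => // et.
by move: ne; rewrite -e1 -e2 -et enum_rankK /= !eqxx.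
Qed.

Lemma pleval_coord i S h : pleval (coord_poly i S) h = plucker (h i) S.
Proof. by rewrite /pleval mevalXU enum_rankK. Qed.

Lemma plevalD P Q h : pleval (P + Q) h = pleval P h + pleval Q h.
Proof. exact: mevalD. Qed.

Lemma plevalM P Q h : pleval (P * Q) h = pleval P h * pleval Q h.
Proof. exact: mevalM. Qed.

Lemma plevalC c h : pleval (c%:MP : plpoly K n I) h = c.
Proof. exact: mevalC. Qed.

End PluckerForms.

Section Germs.
Variables (K : fieldType) (n : nat) (I : finType).
Local Notation pt := (pt K n I).
Variables (X : pt -> Prop) (x : pt).
Implicit Types (y : pt) (f : pt -> K) (P Q : plpoly K n I) (A B : pt -> Prop).

(** The sets where a form does not vanish are a basis of the topology, so this says
    that [A] holds on a neighbourhood of [x] in [X]. *)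
Definition near A : Prop := exists d (Q : plpoly K n I),
  [/\ multihomog d Q, nonvanishing Q x &
      forall y, X y -> nonvanishing Q y -> A y].

(** The condition that [regular_on X f] imposes at the point [x]. *)
Definition regular_at f : Prop := exists d (P Q : plpoly K n I),
  [/\ multihomog d P, multihomog d Q, nonvanishing Q x &
      forall y h, X y -> frames h y -> pleval Q h != 0 ->
        f y = pleval P h / pleval Q h].

Lemma near_all A : (forall y, X y -> A y) -> near A.
Proof.
move=> XA; exists (fun _ _ => 0%N), 1%:MP; split.
- exact: multihomog_const.
- by exists (nearby_frames x); [apply: nearby_framesP | rewrite plevalC oner_eq0].
- by move=> y /XA.
Qed.

Lemma nearS A B : (forall y, X y -> A y -> B y) -> near A -> near B.
Proof.
by move=> AB [d [Q [hQ Qx QA]]]; exists d, Q; split=> // y Xy Qy; apply/AB/QA.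
Qed.

Lemma nearI A B : near A -> near B -> near (fun y => A y /\ B y).
Proof.
move=> [d [P [hP Px PA]]] [e [Q [hQ Qx QB]]]; have hPQ := multihomogM hP hQ.
exists (fun i j => (d i j + e i j)%N), (P * Q); split=> //.
  have fx := nearby_framesP x; apply/(nonvanishingE fx hPQ).
  by rewrite plevalM mulf_neq0 //; [apply/(nonvanishingE fx hP)|apply/(nonvanishingE fx hQ)].
move=> y Xy; have fy := nearby_framesP y; move/(nonvanishingE fy hPQ).
rewrite plevalM mulf_eq0 negb_or => /andP[Py Qy].
by split; [apply/PA|apply/QB] => //; exists (nearby_frames y).
Qed.

Lemma near_forall (T : finType) (A : T -> pt -> Prop) :
  (forall t, near (A t)) -> near (fun y => forall t, A t y).
Proof.
move=> nA; suff : near (fun y => forall t, t \in enum T -> A t y).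
  by apply: nearS => y _ Ay t; apply: Ay; rewrite mem_enum.
elim: (enum T) => [|t s IH]; first exact: near_all.
apply: nearS (nearI (nA t) IH) => y _ [At As] t'.
by rewrite inE => /orP[/eqP->|/As].
Qed.

Lemma regular_near f f' : near (fun y => f y = f' y) ->
  regular_at f -> regular_at f'.
Proof.
move=> [e [R [hR Rx ff']]] [d [P [Q [hP hQ Qx fPQ]]]].
have fx := nearby_framesP x.
exists (fun i j => (d i j + e i j)%N), (P * R), (Q * R); split.
- exact: multihomogM.
- exact: multihomogM.
- exists (nearby_frames x) => //; rewrite plevalM mulf_neq0 //.
    exact/(nonvanishingE fx hQ).
  exact/(nonvanishingE fx hR).
move=> y h Xy hy; rewrite !plevalM mulf_eq0 negb_or => /andP[Qy Ry].
rewrite -ff' //; last by exists h.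
by rewrite (fPQ y h) // invfM mulrACA divff // mulr1.
Qed.

Lemma regular_const c : regular_at (fun=> c).
Proof.
exists (fun _ _ => 0%N), c%:MP, 1%:MP; split; try exact: multihomog_const.
  by exists (nearby_frames x); [apply: nearby_framesP | rewrite plevalC oner_eq0].
by move=> y h _ _ _; rewrite !plevalC divr1.
Qed.

Lemma regular_add f f' : regular_at f -> regular_at f' ->
  regular_at (fun y => f y + f' y).
Proof.
move=> [d [P [Q [hP hQ Qx fPQ]]]] [d' [P' [Q' [hP' hQ' Qx' fPQ']]]].
have fx := nearby_framesP x.
exists (fun i j => (d i j + d' i j)%N), (P * Q' + Q * P'), (Q * Q'); split.
- by apply: multihomogD; apply: multihomogM.
- exact: multihomogM.
- exists (nearby_frames x) => //; rewrite plevalM mulf_neq0 //.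
    exact/(nonvanishingE fx hQ).
  exact/(nonvanishingE fx hQ').
move=> y h Xy hy; rewrite plevalD !plevalM mulf_eq0 negb_or => /andP[Qy Qy'].
by rewrite (fPQ y h) // (fPQ' y h) // addf_div // [pleval Q h * pleval P' h]mulrC.
Qed.

Lemma regular_mul f f' : regular_at f -> regular_at f' ->
  regular_at (fun y => f y * f' y).
Proof.
move=> [d [P [Q [hP hQ Qx fPQ]]]] [d' [P' [Q' [hP' hQ' Qx' fPQ']]]].
have fx := nearby_framesP x.
exists (fun i j => (d i j + d' i j)%N), (P * P'), (Q * Q'); split.
- exact: multihomogM.
- exact: multihomogM.
- exists (nearby_frames x) => //; rewrite plevalM mulf_neq0 //.
    exact/(nonvanishingE fx hQ).
  exact/(nonvanishingE fx hQ').
move=> y h Xy hy; rewrite !plevalM mulf_eq0 negb_or => /andP[Qy Qy'].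
by rewrite (fPQ y h) // (fPQ' y h) // invfM mulrACA.
Qed.

Lemma regular_ext f f' : (forall y, X y -> f y = f' y) ->
  regular_at f -> regular_at f'.
Proof. by move=> ff'; apply/regular_near/near_all. Qed.

Hypothesis Xx : X x.

Lemma near_pt A : near A -> A x.
Proof. by case=> d [Q [hQ Qx QA]]; apply: QA. Qed.

Lemma near_nonzero f : regular_at f -> f x != 0 -> near (fun y => f y != 0).
Proof.
move=> [d [P [Q [hP hQ Qx fPQ]]]] fx0; have fx := nearby_framesP x.
have hPQ := multihomogM hP hQ.
exists (fun i j => (d i j + d i j)%N), (P * Q); split=> //.
  move/(nonvanishingE fx hQ): (Qx) => Q0.
  exists (nearby_frames x) => //; rewrite plevalM mulf_neq0 //.
  by apply: contraNneq fx0 => P0; rewrite (fPQ _ _ Xx fx) // P0 mul0r.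
move=> y Xy [h hy]; rewrite plevalM mulf_eq0 negb_or => /andP[P0 Q0].
by rewrite (fPQ y h) // mulf_neq0 // invr_eq0.
Qed.

(** The inverse of P/Q is written Q^2/(PQ), so that its denominator vanishes
    wherever Q does and f = P/Q is not granted. *)
Lemma regular_inv f : regular_at f -> f x != 0 -> regular_at (fun y => (f y)^-1).
Proof.
move=> [d [P [Q [hP hQ Qx fPQ]]]] fx0; have fx := nearby_framesP x.
exists (fun i j => (d i j + d i j)%N), (Q * Q), (P * Q); split.
- exact: multihomogM.
- exact: multihomogM.
- move/(nonvanishingE fx hQ): (Qx) => Q0.
  exists (nearby_frames x) => //; rewrite plevalM mulf_neq0 //.
  by apply: contraNneq fx0 => P0; rewrite (fPQ _ _ Xx fx) // P0 mul0r.
move=> y h Xy hy; rewrite !plevalM mulf_eq0 negb_or => /andP[P0 Q0].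
by rewrite (fPQ y h) // invf_div invfM mulrACA divff // mulr1.
Qed.

Lemma regular_sum (T : Type) (s : seq T) (R : pred T) (F : T -> pt -> K) :
  (forall t, regular_at (F t)) ->
  regular_at (fun y => \sum_(t <- s | R t) F t y).
Proof.
move=> rF; elim: s => [|t s IH].
  by apply: regular_ext (regular_const 0) => y _; rewrite big_nil.
case Rt: (R t).
  by apply: regular_ext (regular_add (rF t) IH) => y _; rewrite big_cons Rt.
by apply: regular_ext IH => y _; rewrite big_cons Rt.
Qed.

Lemma regular_prod (T : Type) (s : seq T) (R : pred T) (F : T -> pt -> K) :
  (forall t, regular_at (F t)) ->
  regular_at (fun y => \prod_(t <- s | R t) F t y).
Proof.
move=> rF; elim: s => [|t s IH].
  by apply: regular_ext (regular_const 1) => y _; rewrite big_nil.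
case Rt: (R t).
  by apply: regular_ext (regular_mul (rF t) IH) => y _; rewrite big_cons Rt.
by apply: regular_ext IH => y _; rewrite big_cons Rt.
Qed.

Lemma regular_exp f k : regular_at f -> regular_at (fun y => f y ^+ k).
Proof.
move=> rf; elim: k => [|k IH]; first exact: regular_const.
by apply: regular_ext (regular_mul rf IH) => y _; rewrite exprS.
Qed.

Definition regular_mx p q (A : pt -> 'M[K]_(p, q)) : Prop :=
  forall i j, regular_at (fun y => A y i j).

Lemma regular_mx_const p q (C : 'M[K]_(p, q)) : regular_mx (fun=> C).
Proof. by move=> i j; apply: regular_const. Qed.

Lemma regular_mx_mul p q r (A : pt -> 'M[K]_(p, q)) (B : pt -> 'M_(q, r)) :
  regular_mx A -> regular_mx B -> regular_mx (fun y => A y *m B y).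
Proof.
move=> rA rB i j.
apply: (@regular_ext (fun y => \sum_k A y i k * B y k j)) => [y _|].
  by rewrite mxE.
by apply: regular_sum => k; apply: regular_mul.
Qed.

Lemma regular_det p (A : pt -> 'M[K]_p) : regular_mx A ->
  regular_at (fun y => \det (A y)).
Proof.
move=> rA; apply: regular_sum => s; apply: regular_mul.
  exact: regular_const.
exact: regular_prod.
Qed.

Lemma near_unitmx p (A : pt -> 'M[K]_p) : regular_mx A -> A x \in unitmx ->
  near (fun y => A y \in unitmx).
Proof.
move=> rA; rewrite unitmxE unitfE => /(near_nonzero (regular_det rA)).
by apply: nearS => y _; rewrite unitmxE unitfE.
Qed.

Lemma regular_invmx p (A : pt -> 'M[K]_p) : regular_mx A -> A x \in unitmx ->
  regular_mx (fun y => invmx (A y)).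
Proof.
move=> rA Ax i j.
apply: (@regular_near (fun y => (\det (A y))^-1 * \adj (A y) i j)).
  by apply: nearS (near_unitmx rA Ax) => y _ Ay; rewrite /invmx Ay [RHS]mxE.
apply: regular_mul.
  by apply: regular_inv; [apply: regular_det | rewrite -unitfE -unitmxE].
apply: (@regular_ext (fun y => (-1) ^+ (j + i) * \det (row' j (col' i (A y))))).
  by move=> y _; rewrite [RHS]mxE.
apply: regular_mul; first exact: regular_const.
apply: regular_det => k l.
by apply: regular_ext (rA (lift j k) (lift i l)) => y _; rewrite !mxE.
Qed.

End Germs.

(** * Regular families of flags and of unitriangular matrices *)

Section Charts.
Variables (K : fieldType) (n : nat).
Local Notation M := 'M[K]_n.+1.
Implicit Types (g : M).

(** Unlike in [plucker], the rows are listed in any order and may be repeated,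
    which keeps signs out of the cofactor expansions below. *)
Definition row_minor m (f : 'I_m -> 'I_n.+1) g : K :=
  \det (\matrix_(a < m, b < m) g (f a) (inord b)).

Lemma row_minor_plucker m (f : 'I_m -> 'I_n.+1) (S : {set 'I_n.+1}) :
  m = #|S| -> injective f -> (forall a, f a \in S) ->
  exists e : K, forall g, row_minor f g = e * plucker g S.
Proof.
move=> em; subst m => injf fS.
pose s a := enum_rank_in (fS a) (f a).
have sK a : enum_val (s a) = f a by rewrite enum_rankK_in.
have injs : injective s by move=> a b e; apply: injf; rewrite -!sK e.
exists ((-1) ^+ perm injs) => g; rewrite -det_perm -det_mulmx -row_permE.
by congr (\det _); apply/matrixP=> a b; rewrite !mxE permE sK.
Qed.

(** Up to sign a Plücker coordinate, or zero if a row is repeated. *)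
Lemma row_minor_form (I : finType) (i : I) m (f : 'I_m -> 'I_n.+1) :
  exists2 P : plpoly K n I,
    multihomog (fun i' j => ((i' == i) && (j == m))%N : nat) P &
    forall h, pleval P h = row_minor f (h i).
Proof.
have [injf|] := boolP (injectiveb f).
  pose S := [set f a | a : 'I_m].
  have em : m = #|S| by rewrite card_imset ?card_ord //; apply/injectiveP.
  have fS a : f a \in S by apply: imset_f.
  have [e fe] := row_minor_plucker em (injectiveP _ injf) fS.
  exists (e%:MP * coord_poly K i S).
    rewrite em.
    exact: multihomogM (@multihomog_const K n I e) (@multihomog_coord K n I i S).
  by move=> h; rewrite plevalM plevalC pleval_coord fe.
case/injectivePn=> a [b ne_ab fab]; exists 0; first by move=> t; rewrite msupp0.
move=> h; rewrite /pleval meval0 /row_minor.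
by rewrite (determinant_alternate ne_ab) // => c; rewrite !mxE fab.
Qed.

Lemma exists_row_minor g j : g \in unitmx -> (j <= n.+1)%N ->
  exists f : 'I_j -> 'I_n.+1, row_minor f g != 0.
Proof.
move=> gU lej; pose A := \matrix_(p < n.+1, b < j) g p (inord b).
have Afull : row_full A.
  rewrite /row_full -mxrank_tr; apply: inj_row_free => v vA.
  pose B : 'M[K]_(j, n.+1) := \matrix_(b, c) (c == widen_ord lej b)%:R.
  have eA : A^T = B *m g^T.
    apply/matrixP=> b p; rewrite !mxE (bigD1 (widen_ord lej b)) //= !mxE eqxx.
    rewrite mul1r big1 ?addr0 => [|c /negPf ne]; last by rewrite !mxE ne mul0r.
    by congr (g p _); apply: val_inj; rewrite /= inordK // (leq_trans _ lej).
  have : v *m B = 0.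
    have gTU : g^T \in unitmx by rewrite unitmx_tr.
    by rewrite -[LHS](mulmxK gTU) -(mulmxA v B) -eA vA mul0mx.
  move=> vB; apply/matrixP=> k b; rewrite ord1.
  move/matrixP/(_ 0 (widen_ord lej b)): vB; rewrite !mxE (bigD1 b) //= big1.
    by rewrite !mxE eqxx mulr1 addr0.
  move=> c ne; rewrite !mxE (_ : (_ == _) = false) ?mulr0 //.
  by apply/negbTE; apply: contra ne => /eqP[] /val_inj->.
exists (fullrankfun Afull); rewrite /row_minor.
have := fullrowsub_unit Afull; rewrite unitmxE unitfE.
by congr (\det _ != 0); apply/matrixP=> a b; rewrite !mxE.
Qed.

Definition add_row j (f : 'I_j -> 'I_n.+1) (p : 'I_n.+1) (a : 'I_j.+1) :=
  if unlift ord_max a is Some a' then f a' else p.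

Variable f : forall j, 'I_j -> 'I_n.+1.

(** In a chart given by row lists [f j] on which the minors of [g] do not vanish,
    this is a frame of the flag of [g] with entries that are ratios of Plücker
    coordinates of equal size. *)
Definition chart_mx g : M :=
  \matrix_(p, j) (row_minor (add_row (f (j := j)) p) g / row_minor (f (j := j.+1)) g).

(** Expanding the numerator along the row [p] writes column j as a combination
    of columns 0, ..., j of [g], where column j has the minor of size j as
    coefficient. *)
Lemma frame_chart g F : (forall j : 'I_n.+2, row_minor (f (j := j)) g != 0) ->
  frame g F -> frame (chart_mx g) F.
Proof.
move=> fg /frameP[gU ->].
pose cof (j b : nat) : K := (-1) ^+ (j + b) *
  \det (\matrix_(a < j, c < j) g (f a) (inord (bump b c))).
pose T : M := \matrix_(b, j) (if (b <= j)%N then cof j b / row_minor (f (j := j.+1)) g else 0).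
have fg1 (j : 'I_n.+1) : row_minor (f (j := j.+1)) g != 0.
  have lt : (j.+1 < n.+2)%N by rewrite ltnS.
  exact: (fg (Ordinal lt)).
have uT : upper T by move=> b j lt; rewrite mxE leqNgt lt.
have TU : T \in unitmx.
  rewrite unitmxE unitfE upper_det //; apply/prodf_neq0=> j _.
  rewrite mxE leqnn mulf_neq0 ?invr_eq0 //.
  rewrite /cof mulf_neq0 ?signr_eq0 //.
  have lt : (j < n.+2)%N by rewrite ltnS ltnW.
  have := fg (Ordinal lt); rewrite /row_minor /=; congr (\det _ != 0).
  by apply/matrixP=> a c; rewrite !mxE /bump leqNgt ltn_ord.
suff -> : chart_mx g = g *m T.
  apply/frameP; rewrite unitmx_mul gU TU; split=> //.
  by apply/flagmx_eqP; rewrite ?unitmx_mul ?gU // mulKmx.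
apply/matrixP=> p j; rewrite !mxE.
rewrite {1}/row_minor (expand_det_row _ ord_max) mulr_suml.
have lej : (j.+1 <= n.+1)%N by [].
pose G (b : nat) := g p (inord b) * (cof j b / row_minor (f (j := j.+1)) g).
transitivity (\sum_(b < j.+1) G b).
  apply: eq_bigr => b _; rewrite /G mulrA; congr (_ * _ / _).
    by rewrite !mxE /add_row unlift_none.
  rewrite /cofactor /cof; congr (_ * \det _); apply/matrixP=> a c.
  by rewrite !mxE /add_row liftK.
rewrite (big_ord_widen n.+1 G lej) big_mkcond /=; apply: eq_bigr => b _.
by rewrite mxE ltnS /G inord_val; case: ifP => // _; rewrite mulr0.
Qed.

End Charts.

Section RegularFlags.
Variables (K : fieldType) (n : nat) (I : finType).
Local Notation M := 'M[K]_n.+1.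
Local Notation pt := (pt K n I).
Local Notation cm := (@coord_mx K n).
Local Notation cf := (@coord_flag K n).
Implicit Types (y : pt) (E : pt -> flag K n) (A : pt -> M).

Lemma near_sub (X W : pt -> Prop) x B :
  (forall y, W y -> X y) -> near X x B -> near W x B.
Proof.
by move=> WX [d [Q [hQ Qx QB]]]; exists d, Q; split=> // y /WX; apply: QB.
Qed.

Lemma regular_sub (X W : pt -> Prop) x f :
  (forall y, W y -> X y) -> regular_at X x f -> regular_at W x f.
Proof.
move=> WX [d [P [Q [hP hQ Qx fPQ]]]]; exists d, P, Q; split=> // y h /WX.
exact: fPQ.
Qed.

Variables (X : pt -> Prop) (x : pt).
Hypothesis Xx : X x.

(** Frames are only required near [x]: flags that vary regularly need not have a
    regular frame globally. *)
Definition regular_flag E : Prop :=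
  exists2 h : pt -> M, regular_mx X x h & near X x (fun y => frame (h y) (E y)).

Lemma regular_flag_const F : regular_flag (fun=> F).
Proof.
exists (fun=> a_frame F); first exact: regular_mx_const.
by apply: near_all => y _; apply: a_frameP.
Qed.

Lemma regular_flag_ext E E' : (forall y, X y -> E y = E' y) ->
  regular_flag E -> regular_flag E'.
Proof.
move=> EE' [h rh hE]; exists h => //.
by apply: nearS hE => y Xy; rewrite EE'.
Qed.

Lemma frame_gact (g h : M) F : g \in unitmx -> frame h F ->
  frame (g *m h) (gact g F).
Proof.
move=> gU /frameP[hU ->]; apply/frameP; rewrite unitmx_mul gU hU; split=> //.
by rewrite gact_flagmx.
Qed.

Lemma regular_flag_gact A E : regular_mx X x A -> A x \in unitmx ->
  regular_flag E -> regular_flag (fun y => gact (A y) (E y)).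
Proof.
move=> rA Ax [h rh hE]; exists (fun y => A y *m h y).
  exact: regular_mx_mul.
apply: nearS (nearI (near_unitmx Xx rA Ax) hE) => y _ [].
exact: frame_gact.
Qed.

Lemma regular_ratio d (P Q : plpoly K n I) :
  multihomog d P -> multihomog d Q -> nonvanishing Q x ->
  regular_at X x (fun y =>
    pleval P (nearby_frames y) / pleval Q (nearby_frames y)).
Proof.
move=> hP hQ Qx; exists d, P, Q; split=> // y h _ hy Qh.
have [c c0 ce] := pleval_frames d (nearby_framesP y) hy.
by rewrite !ce // invfM mulrACA divff // mul1r.
Qed.

(** The rows are chosen so that the minors do not vanish at [x]; they then do not
    vanish near [x], and the chart frame is regular there. *)
Lemma regular_flag_coord (i : I) : regular_flag (fun y => y i).
Proof.
have ex j : exists f : 'I_j -> 'I_n.+1, (j <= n.+1)%N ->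
    row_minor f (a_frame (x i)) != 0.
  have [lej|] := leqP j n.+1; last by exists (fun=> ord0).
  by have [f fP] := exists_row_minor (a_frame_unit (x i)) lej; exists f.
pose f j : 'I_j -> 'I_n.+1 := projT1 (cid (ex j)).
have fP (j : 'I_n.+2) : row_minor (f j) (a_frame (x i)) != 0.
  by apply: (projT2 (cid (ex j))); rewrite -ltnS.
have fx := nearby_framesP x.
have Qx j (Q : plpoly K n I) : (j <= n.+1)%N ->
    (forall h, pleval Q h = row_minor (f j) (h i)) -> nonvanishing Q x.
  move=> lej hQ; exists (nearby_frames x) => //; rewrite hQ.
  by have lt : (j < n.+2)%N by []; apply: (fP (Ordinal lt)).
exists (fun y => chart_mx f (a_frame (y i))).
  move=> p j; have [P hP PE] := row_minor_form K i (add_row (f j) p).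
  have [Q hQ QE] := row_minor_form K i (f j.+1).
  apply: regular_ext (regular_ratio hP hQ _) => [y _|]; last exact: Qx QE.
  by rewrite mxE PE QE.
apply: (@nearS _ _ _ _ _
    (fun y => forall j : 'I_n.+2, row_minor (f j) (a_frame (y i)) != 0)).
  by move=> y _ fy; apply: frame_chart (a_frameP _).
apply: near_forall => j; have [Q hQ QE] := row_minor_form K i (f j).
have lej : (j <= n.+1)%N by rewrite -ltnS.
exists (fun i' j' => ((i' == i) && (j' == j :> nat))%N : nat), Q; split=> //.
  exact: Qx QE.
by move=> y _ /(nonvanishingE (nearby_framesP y) hQ); rewrite QE.
Qed.

(** A linear system with regular coefficients whose solution is unique at [x]
    can be solved by Cramer's rule near [x]. *)
Lemma regular_solve m p (A : pt -> 'M[K]_(m, p)) (b : pt -> 'cV_m)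
    (s : pt -> 'cV_p) :
  regular_mx X x A -> regular_mx X x b -> row_full (A x) ->
  near X x (fun y => A y *m s y = b y) -> regular_mx X x s.
Proof.
move=> rA rb Afull As i j; pose r := fullrankfun Afull.
have rAr : regular_mx X x (fun y => rowsub r (A y)).
  by move=> k l; apply: regular_ext (rA (r k) l) => y _; rewrite mxE.
have rbr : regular_mx X x (fun y => rowsub r (b y)).
  by move=> k l; apply: regular_ext (rb (r k) l) => y _; rewrite mxE.
have Ax := fullrowsub_unit Afull.
apply: regular_near (regular_mx_mul (regular_invmx Xx rAr Ax) rbr i j).
apply: nearS (nearI (near_unitmx Xx rAr Ax) As) => y _ [AU <-].
by rewrite -mul_rowsub_mx mulKmx.
Qed.

Lemma frame_coord0 (g : M) w p (j : 'I_n.+1) : frame g (cf w) ->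
  (j < w^-1%g p)%N -> g p j = 0.
Proof.
move=> /frameP[gU]; rewrite coord_flagE => /flagmx_eqP.
move=> /(_ (coord_mx_unit K w) gU) u lt; have := u _ _ lt.
by rewrite coord_mxV coord_mx_mul.
Qed.

(** The i-th row of A is a linear form with prescribed values on e_0, ..., e_i,
    and it vanishes on the step y^-1(i) of each flag E, since A maps this step to
    the span of other basis vectors. As y1 and y2 are separating, this is a
    linear system with a unique solution, to which [regular_solve] applies. *)
Lemma regular_unitri A E1 E2 (y1 y2 : 'S_n.+1) : separating y1 y2 ->
  regular_flag E1 -> regular_flag E2 ->
  (forall y, X y -> [/\ unitri (A y), gact (A y) (E1 y) = cf y1
                                    & gact (A y) (E2 y) = cf y2]) ->
  regular_mx X x A.
Proof.
move=> sep [h1 rh1 fr1] [h2 rh2 fr2] AE i.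
(* The unknown is the i-th row of A, written as a column. Its equations come from
   e_0, ..., e_i and from the first z^-1(i) columns of the frames; the other
   equations are replaced by zero to keep the size fixed. *)
pose lowrows : M := \matrix_(m, q) (if (m <= i)%N then (m == q)%:R else 0).
pose B (h : M) z : M :=
  \matrix_(c, q) (if (c < (z : 'S_n.+1)^-1%g i)%N then h q c else 0).
pose L y := col_mx lowrows (col_mx (B (h1 y) y1) (B (h2 y) y2)).
pose b : 'cV[K]_(n.+1 + (n.+1 + n.+1)) :=
  col_mx (\col_m (if (m <= i)%N then (m == i)%:R else 0)) 0.
suff rs : regular_mx X x (fun y => (row i (A y))^T).
  by move=> j; apply: regular_ext (rs j 0) => y _; rewrite !mxE.
have rB h z : regular_mx X x h -> regular_mx X x (fun y => B (h y) z).
  move=> rh c q; case lt: (c < z^-1%g i)%N.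
    by apply: regular_ext (rh q c) => y _; rewrite mxE lt.
  by apply: regular_ext (regular_const X x 0) => y _; rewrite mxE lt.
have rL : regular_mx X x L.
  move=> k l; rewrite /L; case: (split_ordP k) => k' -> {k}.
    by apply: regular_ext (regular_const X x (lowrows k' l)) => y _;
      rewrite col_mxEu.
  case: (split_ordP k') => k ->.
    by apply: regular_ext (rB _ y1 rh1 k l) => y _; rewrite col_mxEd col_mxEu.
  by apply: regular_ext (rB _ y2 rh2 k l) => y _; rewrite !col_mxEd.
have Bz y h E z : X y -> frame h (E y) -> unitri (A y) ->
    gact (A y) (E y) = cf z -> B h z *m (row i (A y))^T = 0.
  move=> Xy hE tA Az; apply/matrixP=> c k; rewrite !mxE.
  have fr : frame (A y *m h) (cf z).
    by rewrite -Az; apply: frame_gact => //; apply: unitri_unit.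
  have [lt|ge] := boolP (c < z^-1%g i)%N; last first.
    by rewrite big1 // => q _; rewrite !mxE (negPf ge) mul0r.
  rewrite -[RHS](frame_coord0 fr lt) mxE; apply: eq_bigr => q _.
  by rewrite !mxE lt mulrC.
apply: (@regular_solve _ _ L (fun=> b)) => //; first exact: regular_mx_const.
  have [tA A1 A2] := AE x Xx; have AU := unitri_unit tA.
  have [f1 f2] := (near_pt Xx fr1, near_pt Xx fr2).
  have [uV _] := unitri_inv tA.
  rewrite /row_full -mxrank_tr; apply: inj_row_free => v /(congr1 trmx).
  rewrite trmx_mul trmxK trmx0 !mul_col_mx => vL.
  have [v0 v1 v2] : [/\ lowrows *m v^T = 0, B (h1 x) y1 *m v^T = 0
                       & B (h2 x) y2 *m v^T = 0].
    have z3 : 0 = col_mx 0 (col_mx 0 0) :> 'cV[K]_(n.+1 + (n.+1 + n.+1)).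
      by rewrite !col_mx0.
    by move: vL; rewrite z3 => /eq_col_mx[-> /eq_col_mx[-> ->]].
  have vlow (m : 'I_n.+1) : (m <= i)%N -> v 0 m = 0.
    move=> le; move/matrixP/(_ m 0): v0; rewrite !mxE (bigD1 m) //= !mxE le eqxx.
    rewrite mul1r big1 ?addr0 // => q ne; rewrite !mxE le eq_sym (negPf ne).
    by rewrite mul0r.
  (* The form v A^-1 vanishes at e_q: for q <= i because A^-1 is triangular and v
     vanishes at e_0, ..., e_q, and for q > i because the separation property puts
     e_q into the image under A of one of the two steps. *)
  suff vV0 : v *m invmx (A x) = 0.
    by rewrite -[v](mulmxKV AU) vV0 mul0mx.
  have far (h : M) E (z : 'S_n.+1) q : frame h (E x) -> gact (A x) (E x) = cf z ->
      B h z *m v^T = 0 -> (z^-1%g q < z^-1%g i)%N -> (v *m invmx (A x)) 0 q = 0.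
    move=> fr Az vB lt.
    have fr' : frame (A x *m h) (cf z) by rewrite -Az; apply: frame_gact.
    have lt2 : (z^-1%g i < n.+2)%N by rewrite ltnS ltnW.
    have : delta_mx q 0 \in col_span (A x *m h) (z^-1%g i).
      have := fr' (Ordinal lt2); rewrite coord_flagE flagmxE ?coord_mx_unit //.
      move=> /= <-; rewrite (_ : delta_mx q 0 = col (z^-1%g q) (cm z)).
        by apply/memv_span/map_f; rewrite mem_filter lt mem_enum.
      by apply/matrixP=> k l; rewrite !mxE permKV ord1 eqxx andbT.
    move/(@mulmx_col_span0 _ _ _ (v *m invmx (A x))).
    rewrite -colE => /(_ _)/matrixP/(_ 0 0); rewrite !mxE; apply => c ltc.
    rewrite col_mulmx mulmxA mulmxKV //; apply/matrixP=> k l.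
    have := congr1 (fun C : 'cV[K]_n.+1 => C c 0) vB; rewrite !mxE => vc.
    rewrite -[RHS]vc !ord1; apply: eq_bigr => m _.
    by rewrite !mxE ltc mulrC.
  apply/matrixP=> k q; rewrite ord1 !mxE.
  have [le_qi|lt_iq] := leqP q i.
    rewrite big1 // => m _; have [le|lt] := leqP m q.
      by rewrite vlow ?mul0r // (leq_trans le).
    by rewrite uV ?mulr0.
  case/orP: (sep i q lt_iq) => lt.
    by have := far _ _ _ _ f1 A1 v1 lt; rewrite mxE.
  by have := far _ _ _ _ f2 A2 v2 lt; rewrite mxE.
apply: nearS (nearI fr1 fr2) => y Xy [f1 f2]; have [tA A1 A2] := AE y Xy.
rewrite /L !mul_col_mx (Bz y _ E1) // (Bz y _ E2) // col_mx0.
rewrite /b; congr col_mx; apply/matrixP=> m k; rewrite !mxE.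
case: ifP => le; last by rewrite big1 // => q _; rewrite !mxE le mul0r.
rewrite (bigD1 m) //= !mxE le eqxx mul1r big1 ?addr0; last first.
  by move=> q ne; rewrite !mxE le eq_sym (negPf ne) mul0r.
case: tA => uA dA; case: eqP => [->|/eqP ne]; first by rewrite dA.
by rewrite uA // ltn_neqAle ne.
Qed.

End RegularFlags.

Section Morphisms.
Variables (K : fieldType) (n : nat) (I J : finType).
Variables (X : pt K n I -> Prop) (Y : pt K n J -> Prop).
Variable phi : pt K n I -> pt K n J.

(** Multihomogeneous forms on the target, evaluated on regular frames of the
    components, are regular functions on the source. *)
Lemma morphism_regular_flags :
  (forall x, X x -> Y (phi x)) ->
  (forall x j, X x -> regular_flag X x (fun y => phi y j)) ->
  Defs.morphism X Y phi.
Proof.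
move=> XY rphi.
have pull x : X x -> exists2 h : pt K n I -> J -> 'M[K]_n.+1,
    near X x (fun y => frames (h y) (phi y)) &
    forall P, regular_at X x (fun y => pleval P (h y)).
  move=> Xx; have /choice[h hP] j : exists h : pt K n I -> 'M[K]_n.+1,
      regular_mx X x h /\ near X x (fun y => frame (h y) (phi y j)).
    by have [h] := rphi x j Xx; exists h.
  exists (fun y j => h j y).
    by apply: near_forall => j; have [] := hP j.
  move=> P; apply: (regular_ext (fun y _ => esym (mevalE _ P))).
  apply: regular_sum => m; apply: regular_mul; first exact: regular_const.
  apply: regular_prod => t; apply: regular_exp; apply: regular_det => a b.
  have [rh _] := hP (enum_val t).1.
  by apply: regular_ext (rh _ _) => y _; rewrite mxE.
split=> // [V|V f] [VY Vop].
  split=> [x []//|x [Xx Vx]].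
  have [h hphi hreg] := pull x Xx; have hx := near_pt Xx hphi.
  have [d [Q [hQ Qx QV]]] := Vop _ Vx.
  have : near X x (fun y => X y /\ V (phi y)); last by [].
  have /(nonvanishingE hx hQ) Q0 := Qx.
  apply: nearS (nearI hphi (near_nonzero Xx (hreg Q) Q0)) => y Xy [hy Qy].
  by split=> //; apply: QV; [apply: XY | exists (h y)].
move=> fV x [Xx Vx]; have [h hphi hreg] := pull x Xx.
have hx := near_pt Xx hphi; have [d [P [Q [hP hQ Qx fPQ]]]] := fV _ Vx.
have /(nonvanishingE hx hQ) Q0 := Qx.
pose W y := X y /\ V (phi y); have WX y : W y -> X y by case.
have nW := nearI hphi (near_nonzero Xx (hreg Q) Q0).
have rW := regular_mul (hreg P) (regular_inv Xx (hreg Q) Q0).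
apply: (regular_near _ (regular_sub WX rW)).
apply: nearS (near_sub WX nW) => y [_ Vy] [hy Qy].
by rewrite /= (fPQ _ _ Vy hy).
Qed.

End Morphisms.

(** * Gluing two braid varieties *)

Section TriangularTransporter.
Variables (K : fieldType) (n : nat).
Local Notation M := 'M[K]_n.+1.
Local Notation flag := (flag K n).
Local Notation cm := (@coord_mx K n).
Local Notation cf := (@coord_flag K n).
Implicit Types (A : M) (E F : flag) (y z : 'S_n.+1) (a b : seq 'I_n).

Lemma gact_coordK y F : gact (cm y^-1%g) (gact (cm y) F) = F.
Proof. by rewrite -coord_mxV gactK // coord_mx_unit. Qed.

Lemma gact_coordKV y F : gact (cm y) (gact (cm y^-1%g) F) = F.
Proof. by rewrite -coord_mxV gactKV // coord_mx_unit. Qed.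

Lemma gact_w0K F : gact (cm w0) (gact (cm w0) F) = F.
Proof. by have := gact_coordK w0 F; rewrite w0V. Qed.

Lemma gact_w0_std : gact (cm w0) std_flag = ant_flag.
Proof. by rewrite gact_coord /permc mul1g. Qed.

Lemma gact_w0_ant : gact (cm w0) ant_flag = std_flag.
Proof. by rewrite -gact_w0_std gact_w0K. Qed.

(** Unique, when it exists and y1 and y2 are separating; hence a regular
    function of E1 and E2 by [regular_unitri]. *)
Definition transporter y1 y2 E1 E2 : M :=
  if pselect (exists A, [/\ unitri A, gact A E1 = cf y1 & gact A E2 = cf y2])
    is left e then projT1 (cid e) else 1%:M.

Lemma transporterP y1 y2 E1 E2 :
  (exists A, [/\ unitri A, gact A E1 = cf y1 & gact A E2 = cf y2]) ->
  let A := transporter y1 y2 E1 E2 in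
  [/\ unitri A, gact A E1 = cf y1 & gact A E2 = cf y2].
Proof.
by move=> ex; rewrite /transporter; case: pselect => [e|//]; case: (cid e).
Qed.

Lemma transporterE y1 y2 E1 E2 A : separating y1 y2 ->
  unitri A -> gact A E1 = cf y1 -> gact A E2 = cf y2 ->
  transporter y1 y2 E1 E2 = A.
Proof.
move=> sep tA A1 A2; have [|tB B1 B2] := @transporterP y1 y2 E1 E2.
  by exists A.
exact: unitri_uniq sep tB tA B1 B2 A1 A2.
Qed.

Lemma coord_path0 a : coord_path K a 0 = std_flag.
Proof. by rewrite /coord_path take0. Qed.

Lemma coord_path_size a : coord_path K a (size a) = cf (word_perm a).
Proof. by rewrite /coord_path take_size. Qed.

Lemma gact_coord_path a A j : reduced a -> unitri A ->
  gact A (cf (word_perm a)) = cf (word_perm a) -> (j <= size a)%N ->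
  gact A (coord_path K a j) = coord_path K a j.
Proof.
move=> ra tA; have AU := unitri_unit tA; have [uA _] := tA.
move=> /(stab_coordP _ AU) za lej; apply/stab_coordP => // k l lt.
set y := word_perm _; have [lt'|] := ltnP (y k) (y l); last first.
  rewrite leq_eqVlt => /orP[/eqP/val_inj/perm_inj e|]; last exact: uA.
  by rewrite e ltnn in lt.
have [lta|] := ltnP ((word_perm a)^-1%g (y k)) ((word_perm a)^-1%g (y l)).
  have := reduced_prefix_noninv ra lt' lta lej.
  by rewrite -/y !permK ltnNge ltnW.
rewrite leq_eqVlt => /orP[/eqP/val_inj/perm_inj/perm_inj e|/za].
  by rewrite e ltnn in lt.
by rewrite !permKV.
Qed.

(** A path along a reduced word is recovered from its endpoint: it is the translate
    by some u of the coordinate path, and A u, which fixes the last coordinate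
    flag, fixes them all. *)
Lemma reduced_path_end a f A j : reduced a -> f 0%N = std_flag -> steps a f ->
  unitri A -> gact A (f (size a)) = cf (word_perm a) -> (j <= size a)%N ->
  gact (invmx A) (coord_path K a j) = f j.
Proof.
move=> ra f0 st tA Af lej; have [u tu fu] := reduced_path ra f0 st.
have AU := unitri_unit tA; have uU := unitri_unit tu.
rewrite fu //; apply: (gact_inj AU); rewrite gactKV // -gactM //.
rewrite gact_coord_path //; first exact: unitriM.
by rewrite (gactM _ AU uU) -[RHS]Af (fu _ (leqnn _)) coord_path_size.
Qed.

Lemma steps_coord_rev b :
  steps b (fun j => coord_path K (rev b) (size b - j)).
Proof.
by have := steps_rev (@steps_coord K n (rev b)); rewrite revK size_rev.
Qed.

End TriangularTransporter.

Section Splitting.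
Variables (K : fieldType) (n : nat).
Local Notation M := 'M[K]_n.+1.
Local Notation flag := (flag K n).
Local Notation cm := (@coord_mx K n).
Local Notation cf := (@coord_flag K n).

(** Indices in [nat] avoid casts between the ordinals of different words. *)
Definition at_ord N (F : pt K n 'I_N.+1) (k : nat) : flag := F (inord k).

Lemma braid_varietyP (c : seq 'I_n) (F : pt K n 'I_(size c).+1) :
  braid_variety K c F <->
  [/\ at_ord F 0 = std_flag, at_ord F (size c) = ant_flag & steps c (at_ord F)].
Proof.
have e0 : inord 0 = ord0 :> 'I_(size c).+1 by apply: val_inj; rewrite /= inordK.
have em : inord (size c) = ord_max :> 'I_(size c).+1.
  by apply: val_inj; rewrite /= inordK.
have el (j : 'I_(size c)) : inord j = widen_ord (leqnSn _) j.
  by apply: val_inj; rewrite /= inordK // ltnS ltnW.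
have er (j : 'I_(size c)) : inord j.+1 = lift ord0 j.
  by apply: val_inj; rewrite /= inordK // ltnS.
have en (j : 'I_(size c)) : nth 1%g (map (@simple_tr n) c) j
    = simple_tr (tnth (in_tuple c) j).
  by rewrite (nth_map (tnth (in_tuple c) j)) // [in RHS](tnth_nth (tnth (in_tuple c) j)).
rewrite /at_ord e0 em; split=> -[F0 Fm st]; split=> //.
  by move=> j lt; have := st (Ordinal lt); rewrite -el -er -en.
by move=> j; have := st j (ltn_ord j); rewrite el er en.
Qed.

Variables (beta : seq 'I_n) (r1 : nat) (w : 'S_n.+1) (a b : seq 'I_n).
Hypothesis le_r1 : (r1 <= size beta)%N.
Hypothesis ha : reduced_expr (permc (w^-1)%g w0) a.
Hypothesis hb : reduced_expr w b.

(** The permutation of the word a, and x w0 = w^-1 that of the reverse of b. *)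
Let x : 'S_n.+1 := permc w^-1%g w0.
Let m := size beta.
Let beta1 := take r1 beta.
Let beta2 := drop r1 beta.
Let I := ('I_(size (a ++ beta1)).+1 + 'I_(size (beta2 ++ b)).+1)%type.
Let J := 'I_m.+1.

Let X := prod_var (braid_variety K (a ++ beta1)) (braid_variety K (beta2 ++ b)).
Let Y : pt K n J -> Prop := U_var K beta r1 w.

Let size1 : size beta1 = r1.
Proof. by rewrite size_takel. Qed.

Let size2 : size beta2 = (m - r1)%N.
Proof. by rewrite size_drop. Qed.

Let size_a1 : size (a ++ beta1) = (size a + r1)%N.
Proof. by rewrite size_cat size1. Qed.

Let size_2b : size (beta2 ++ b) = (m - r1 + size b)%N.
Proof. by rewrite size_cat size2. Qed.

Let steps_beta (f : nat -> flag) : steps beta f <->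
  steps beta1 f /\ steps beta2 (fun j => f (r1 + j)%N).
Proof. by have := steps_cat beta1 beta2 f; rewrite size1 cat_take_drop. Qed.

Let word_a : word_perm a = x.
Proof. by case: ha. Qed.

Let word_b : word_perm (rev b) = permc x w0.
Proof. by rewrite word_perm_rev permc_w0K; case: hb => ->. Qed.

Let red_a : reduced a.
Proof. by rewrite /reduced word_a. Qed.

Let red_b : reduced (rev b).
Proof. by apply: reduced_rev; rewrite /reduced; case: (hb) => ->. Qed.

Let G (z : pt K n I) (k : nat) : flag := z (inl (inord k)).
Let H (z : pt K n I) (k : nat) : flag := z (inr (inord k)).

(** The a-part of the first path and the b-part of the second are translates of
    coordinate paths by the same matrix, and D is its inverse. It is determined by
    the flags where these two parts meet the rest. *)
Let D (z : pt K n I) : M := transporter x (permc x w0)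
  (G z (size a)) (gact (cm w0) (H z (m - r1))).

(** The a-part of the first path and the b-part of the second are dropped, and
    the rest is concatenated; the two pieces meet at the antistandard flag,
    which is w0 times the standard one. *)
Let middle (z : pt K n I) (k : nat) : flag :=
  if (k <= r1)%N then G z (size a + k) else gact (cm w0) (H z (k - r1)).

Definition glue (z : pt K n I) : pt K n J :=
  [ffun k : J => gact (cm x^-1%g) (gact (D z) (middle z k))].

(** The pair (w0, w0) is separating, so a single flag, repeated, determines C. *)
Let C (F : pt K n J) : M := transporter w0 w0
  (gact (cm x) (at_ord F r1)) (gact (cm x) (at_ord F r1)).

(** The dropped ends are restored as translates of coordinate paths. *)
Let left_part (F : pt K n J) (k : nat) : flag :=
  if (k < size a)%N then gact (C F) (coord_path K a k)
  else gact (C F) (gact (cm x) (at_ord F (k - size a))).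

Let right_part (F : pt K n J) (k : nat) : flag :=
  gact (cm w0) (if (k <= m - r1)%N
    then gact (C F) (gact (cm x) (at_ord F (r1 + k)))
    else gact (C F) (coord_path K (rev b) (m - r1 + size b - k))).

Definition cut (F : pt K n J) : pt K n I :=
  [ffun s : I => match s with inl k => left_part F k | inr k => right_part F k end].

Let XP z : X z -> [/\ G z 0 = std_flag, G z (size a + r1) = ant_flag,
   steps a (G z) & steps beta1 (fun j => G z (size a + j))]
  /\ [/\ H z 0 = std_flag, H z (m - r1 + size b) = ant_flag,
   steps beta2 (H z) & steps b (fun j => H z (m - r1 + j))].
Proof.
have eG : at_ord [ffun i => z (inl i)] = G z by apply/funext => k; rewrite /at_ord ffunE.
have eH : at_ord [ffun i => z (inr i)] = H z by apply/funext => k; rewrite /at_ord ffunE.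
case=> /braid_varietyP; rewrite eG => -[G0 G1 /steps_cat[Ga Gb]].
move=> /braid_varietyP; rewrite eH => -[H0 H1 /steps_cat[]].
by rewrite size2 -size_a1 -size_2b.
Qed.

Let Xbuild z : [/\ G z 0 = std_flag, G z (size a + r1) = ant_flag,
   steps a (G z) & steps beta1 (fun j => G z (size a + j))] ->
   [/\ H z 0 = std_flag, H z (m - r1 + size b) = ant_flag,
   steps beta2 (H z) & steps b (fun j => H z (m - r1 + j))] -> X z.
Proof.
have eG : at_ord [ffun i => z (inl i)] = G z by apply/funext => k; rewrite /at_ord ffunE.
have eH : at_ord [ffun i => z (inr i)] = H z by apply/funext => k; rewrite /at_ord ffunE.
move=> [G0 G1 Ga Gb] [H0 H1 Ha Hb]; split; apply/braid_varietyP.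
  by rewrite eG size_a1; split=> //; apply/steps_cat.
by rewrite eH size_2b; split=> //; apply/steps_cat; rewrite size2.
Qed.

Let middle_right z k : X z -> (r1 <= k)%N ->
  middle z k = gact (cm w0) (H z (k - r1)).
Proof.
move=> /XP[[_ G1 _ _] [H0 _ _ _]]; rewrite /middle leq_eqVlt => /orP[/eqP<-|lt].
  by rewrite leqnn subnn G1 H0 gact_w0_std.
by rewrite leqNgt lt.
Qed.

(** The b-part of the second path, reversed and moved by w0, starts at the standard
    flag, as [reduced_path] requires. *)
Let right_rev z k := gact (cm w0) (H z (m - r1 + size b - k)).

Let right_revP z : X z ->
  right_rev z 0 = std_flag /\ steps (rev b) (right_rev z).
Proof.
move=> /XP[_ [_ H1 _ Hb]]; rewrite /right_rev subn0 H1 gact_w0_ant; split=> //.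
apply: steps_ext (steps_gact (coord_mx_unit K w0) (steps_rev Hb)) => j.
by rewrite size_rev /= => lej; rewrite addnBA.
Qed.

Let right_rev_size z : right_rev z (size (rev b)) = gact (cm w0) (H z (m - r1)).
Proof. by rewrite /right_rev size_rev addnK. Qed.

Let DP z : X z -> [/\ unitri (D z), gact (D z) (G z (size a)) = cf x &
  gact (D z) (gact (cm w0) (H z (m - r1))) = cf (permc x w0)].
Proof.
move=> Xz; apply: transporterP; have [[G0 _ Ga _] _] := XP Xz.
have [R0 Rb] := right_revP Xz.
have [u tu Gu] := reduced_path red_a G0 Ga.
have [v tv Rv] := reduced_path red_b R0 Rb.
have [A tA [A1 A2]] := unitri_common x tu tv; have AU := unitri_unit tA.
exists (invmx A); split; first exact: unitri_inv.
  by rewrite Gu // coord_path_size word_a -A1 gactK.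
by rewrite -right_rev_size Rv // coord_path_size word_b -A2 gactK.
Qed.

Let CP F : Y F -> unitri (C F) /\ gact (C F) (gact (cm x) (at_ord F r1)) = ant_flag.
Proof.
case=> _ tr; suff [A tA AF] : exists2 A, unitri A &
    gact A (gact (cm x) (at_ord F r1)) = ant_flag.
  have [|tC CF _] := @transporterP K n w0 w0 (gact (cm x) (at_ord F r1))
    (gact (cm x) (at_ord F r1)); last by [].
  by exists A.
apply: transverse_std; have := rel_pos_gact (coord_mx_unit K x) tr.
rewrite gact_coord; congr (rel_pos _ _ (cf _)); apply/permP=> p.
by rewrite !permcE w0K permK perm1.
Qed.

Let glue_at z k : (k <= m)%N ->
  at_ord (glue z) k = gact (cm x^-1%g) (gact (D z) (middle z k)).
Proof. by move=> lek; rewrite /at_ord ffunE inordK. Qed.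

Let glue_in z : X z -> Y (glue z).
Proof.
move=> Xz; have [tD D1 D2] := DP Xz; have DU := unitri_unit tD.
have [[G0 G1 Ga Gb] [H0 H1 Ha Hb]] := XP Xz.
have x1 : permc x^-1%g x = 1%g by rewrite /permc mulgV.
split; last first.
  rewrite -/(at_ord _ _) glue_at // /middle leqnn G1.
  apply/rel_posP; exists (cm w0 *m (invmx (D z) *m cm x)).
    by rewrite !unitmx_mul unitmx_inv DU !coord_mx_unit.
  rewrite !gactM ?unitmx_mul ?unitmx_inv ?DU ?coord_mx_unit //.
  rewrite gact_coordKV gactK // gact_w0_ant; split=> //.
  rewrite gact_coord (_ : permc x _ = 1%g).
    by rewrite gact_unitri_std ?gact_w0_std //; apply: unitri_inv.
  by apply/permP=> p; rewrite !permcE w0K permK perm1.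
apply/braid_varietyP; split.
- by rewrite glue_at // /middle addn0 D1 gact_coord x1.
- rewrite glue_at // middle_right // D2 gact_coord.
  by rewrite permcA x1 /ant_flag /permc mulg1.
apply/steps_beta.
have st c f : steps c f -> steps c (fun j => gact (cm x^-1%g) (gact (D z) (f j))).
  by move=> cf; apply: steps_gact (coord_mx_unit K _) (steps_gact DU cf).
split.
  apply: steps_ext (st _ _ Gb) => j; rewrite size1 => lej.
  by rewrite glue_at ?(leq_trans lej) // /middle lej.
apply: steps_ext (st _ _ (steps_gact (coord_mx_unit K w0) Ha)) => j; rewrite size2 => lej.
rewrite glue_at; last by rewrite -leq_subRL.
by rewrite (middle_right Xz (leq_addr _ _)) addKn.
Qed.

Let left_part_le F k : Y F -> (k <= size a)%N ->
  left_part F k = gact (C F) (coord_path K a k).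
Proof.
move=> [/braid_varietyP[F0 _ _] _]; rewrite /left_part leq_eqVlt.
case/orP=> [/eqP->|->//]; rewrite ltnn subnn F0 gact_coord.
by rewrite coord_path_size word_a /permc mul1g.
Qed.

Let left_part_ge F k : left_part F (size a + k) =
  gact (C F) (gact (cm x) (at_ord F k)).
Proof. by rewrite /left_part ltnNge leq_addr addKn. Qed.

Let right_part_ge F k : Y F -> (k <= size b)%N -> right_part F (m - r1 + k) =
  gact (cm w0) (gact (C F) (coord_path K (rev b) (size b - k))).
Proof.
move=> [/braid_varietyP[_ F1 _] _] lek; rewrite /right_part subnDl.
case: k lek => [|k] lek; last by rewrite ifF // -[X in (_ <= X)%N]addn0 leq_add2l.
rewrite addn0 leqnn subn0 subnKC // F1 -size_rev coord_path_size word_b.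
by rewrite gact_coord.
Qed.

Let G_cut F k : (k <= size a + r1)%N -> G (cut F) k = left_part F k.
Proof. by move=> lek; rewrite /G ffunE inordK // ltnS size_a1. Qed.

Let H_cut F k : (k <= m - r1 + size b)%N -> H (cut F) k = right_part F k.
Proof. by move=> lek; rewrite /H ffunE inordK // ltnS size_2b. Qed.

Let cut_in F : Y F -> X (cut F).
Proof.
move=> YF; have [tC CF] := CP YF; have CU := unitri_unit tC.
have [/braid_varietyP[F0 F1 Fst] _] := YF.
move/steps_beta: Fst => [Fst1 Fst2].
apply: Xbuild; split.
- by rewrite G_cut // left_part_le // coord_path0 gact_unitri_std.
- by rewrite G_cut // left_part_ge CF.
- apply: steps_ext (steps_gact CU (@steps_coord K n a)) => j lej /=.
  by rewrite G_cut ?left_part_le // (leq_trans lej) ?leq_addr.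
- apply: steps_ext (steps_gact CU (steps_gact (coord_mx_unit K x) Fst1)) => j.
  by rewrite size1 /= => lej; rewrite G_cut ?leq_add2l // left_part_ge.
- by rewrite H_cut // /right_part leq0n addn0 CF gact_w0_ant.
- by rewrite H_cut // right_part_ge // subnn coord_path0 gact_unitri_std ?gact_w0_std.
- apply: steps_ext (steps_gact (coord_mx_unit K w0)
    (steps_gact CU (steps_gact (coord_mx_unit K x) Fst2))) => j.
  rewrite size2 /= => lej; rewrite H_cut ?(leq_trans lej) ?leq_addr //.
  by rewrite /right_part lej.
apply: steps_ext (steps_gact (coord_mx_unit K w0)
  (steps_gact CU (@steps_coord_rev K n b))) => j lej /=.
by rewrite H_cut ?leq_add2l // right_part_ge.
Qed.

Let C_glue z : X z -> C (glue z) = invmx (D z).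
Proof.
move=> Xz; have [tD _ _] := DP Xz; have DU := unitri_unit tD.
have [[_ G1 _ _] _] := XP Xz.
have e : gact (invmx (D z)) (gact (cm x) (at_ord (glue z) r1)) = ant_flag.
  by rewrite glue_at // gact_coordKV gactK // /middle leqnn.
by apply: transporterE => //; [apply: separating_w0 | apply: unitri_inv].
Qed.

Let D_cut F : Y F -> D (cut F) = invmx (C F).
Proof.
move=> YF; have [tC _] := CP YF; have CU := unitri_unit tC.
have [/braid_varietyP[F0 F1 _] _] := YF.
apply: transporterE; [exact: separating_opp | exact: unitri_inv | |].
  by rewrite G_cut ?leq_addr // left_part_le // gactK // coord_path_size word_a.
rewrite H_cut ?leq_addr // -[X in right_part _ X]addn0 right_part_ge //.
by rewrite gact_w0K gactK // subn0 -size_rev coord_path_size word_b.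
Qed.

Let glueK z : X z -> cut (glue z) = z.
Proof.
move=> Xz; have [tD D1 D2] := DP Xz; have DU := unitri_unit tD.
have [[G0 _ Ga _] _] := XP Xz; have [R0 Rb] := right_revP Xz.
have mid k : (k <= m)%N ->
    gact (C (glue z)) (gact (cm x) (at_ord (glue z) k)) = middle z k.
  by move=> lek; rewrite C_glue // glue_at // gact_coordKV gactK.
apply/ffunP=> -[] k; rewrite ffunE -[in RHS](inord_val k).
  have lek : (k <= size a + r1)%N by rewrite -ltnS -size_a1.
  rewrite -/(G z k) /left_part; case: ltnP => [lt|ge].
    rewrite C_glue //; apply: (reduced_path_end red_a G0 Ga tD _ (ltnW lt)).
    by rewrite word_a.
  have le1 : (k - size a <= r1)%N by rewrite leq_subLR.
  by rewrite mid ?(leq_trans le1) // /middle le1 subnKC.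
have lek : (k <= m - r1 + size b)%N by rewrite -ltnS -size_2b.
rewrite -/(H z k) /right_part; case: leqP => [le|gt].
  rewrite mid -?leq_subRL // middle_right ?leq_addr // addKn gact_w0K //.
have le1 : (m - r1 + size b - k <= size (rev b))%N.
  by rewrite size_rev leq_subLR leq_add2r ltnW.
rewrite C_glue // (reduced_path_end red_b R0 Rb tD _ le1).
  by rewrite /right_rev subKn // gact_w0K.
by rewrite right_rev_size D2 word_b.
Qed.

Let cutK F : Y F -> glue (cut F) = F.
Proof.
move=> YF; have [tC _] := CP YF; have CU := unitri_unit tC.
apply/ffunP=> k; rewrite ffunE D_cut // -[in RHS](inord_val k).
rewrite -/(at_ord F k) -[RHS](gact_coordK x); congr gact.
rewrite -[RHS](gactK _ CU); congr gact.
have lek : (k <= m)%N by rewrite -ltnS.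
rewrite /middle; case: leqP => [le|gt].
  by rewrite G_cut ?leq_add2l // left_part_ge.
rewrite H_cut; last by rewrite (leq_trans (leq_sub2r _ lek)) ?leq_addr.
by rewrite /right_part leq_sub2r // subnKC ?gact_w0K // ltnW.
Qed.

Let regular_coord_gact (T : finType) (Z : pt K n T -> Prop) z E y : Z z ->
  regular_flag Z z E -> regular_flag Z z (fun u => gact (cm y) (E u)).
Proof.
move=> Zz; apply: (@regular_flag_gact K n T Z z Zz (fun=> cm y)).
  exact: regular_mx_const.
exact: coord_mx_unit.
Qed.

Let glue_morphism : Defs.morphism X Y glue.
Proof.
apply: morphism_regular_flags => [|z k Xz]; first exact: glue_in.
have [tD _ _] := DP Xz.
have rG j : regular_flag X z (fun u => G u j) by apply: regular_flag_coord.
have rH j : regular_flag X z (fun u => H u j) by apply: regular_flag_coord.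
have rD : regular_mx X z D.
  apply: (regular_unitri Xz (@separating_opp n x) (rG (size a))
    (regular_coord_gact w0 Xz (rH (m - r1)%N))).
  by move=> u /DP.
apply: (@regular_flag_ext _ _ _ _ _
  (fun u => gact (cm x^-1%g) (gact (D u) (middle u k)))).
  by move=> u _; rewrite ffunE.
apply: regular_coord_gact => //; apply: regular_flag_gact => //.
  exact: unitri_unit.
by rewrite /middle; case: (k <= r1)%N; last apply: regular_coord_gact.
Qed.

Let cut_morphism : Defs.morphism Y X cut.
Proof.
apply: morphism_regular_flags => [|F k YF]; first exact: cut_in.
have [tC _] := CP YF; have CU := unitri_unit tC.
have rF j : regular_flag Y F (fun u => gact (cm x) (at_ord u j)).
  by apply: regular_coord_gact => //; apply: regular_flag_coord.
have rC : regular_mx Y F C.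
  apply: (regular_unitri YF (@separating_w0 n) (rF r1) (rF r1)).
  by move=> u /CP[].
apply: (@regular_flag_ext _ _ _ _ _
  (fun u => match k with inl j => left_part u j | inr j => right_part u j end)).
  by move=> u _; rewrite ffunE.
case: k => k.
  rewrite /left_part; case: (k < size a)%N; apply: regular_flag_gact => //.
  exact: regular_flag_const.
rewrite /right_part; apply: regular_coord_gact => //.
case: (k <= m - r1)%N; apply: regular_flag_gact => //.
exact: regular_flag_const.
Qed.

Lemma isomorphic_U_var : isomorphic X Y.
Proof.
exists glue, cut; split; [exact: glue_morphism | exact: cut_morphism | |].
  exact: glueK.
exact: cutK.
Qed.

End Splitting.

Theorem theorem1p1 (R : realType) (n : nat) (beta : seq 'I_n)
    (hbeta : exists2 gamma : seq 'I_n,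
      subseq gamma beta & reduced_expr w0 gamma)
    (r1 : nat) (hr1 : (1 <= r1 <= size beta)%N) (w : 'S_n.+1)
    (a b : seq 'I_n)
    (ha : reduced_expr (permc (w^-1)%g w0) a) (hb : reduced_expr w b) :
  isomorphic
    (prod_var (braid_variety (complex R) (a ++ take r1 beta))
              (braid_variety (complex R) (drop r1 beta ++ b)))
    (U_var (complex R) beta r1 w).
Proof. by case/andP: hr1 => _ le_r1; apply: isomorphic_U_var. Qed.
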